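(* Consider the interconnected ODE/PDE system, the relation $\Delta$, the filter $\Psi$ and the matrices $\mathcal{A},\mathcal{B},\mathcal{C},\mathcal{D}$ described in the context. Let $P\in\mathbb{S}^{n_\xi+n}$, $M=M^\top\in\mathbb{R}^{p_\psi\times p_\psi}$ and $Z\in\mathbb{S}^{n_\xi}$ be such that $M$ defines a finite horizon IQC with terminal cost $Z$ with respect to the filter $\Psi$, i.e. $$\int_0^T \psi(t)^\top M\psi(t)\,dt+\xi(T)^\top Z\,\xi(T)\ge 0\qquad\text{for all } T\ge 0$$ along all trajectories of the PDE with its boundary conditions and of the filter. Suppose moreover that $$ (K_\circ^{\perp})^\top \begin{bmatrix} I & 0\\ \mathcal{A}&\mathcal{B}\\ \mathcal{C}&\mathcal{D}\end{bmatrix}^\top \begin{bmatrix} 0&P&0\\ P&0&0\\ 0&0&M\end{bmatrix}\begin{bmatrix} I & 0\\ \mathcal{A}&\mathcal{B}\\ \mathcal{C}&\mathcal{D}\end{bmatrix} K_\circ^{\perp}\prec 0 \qquad\text{and}\qquad P-\begin{bmatrix} Z&0\\0&0_{n}\end{bmatrix}\succ 0,$$ where $K_\circ=\begin{bmatrix}0_{ml,n_\xi} & KC & -K_{\mathscr{B}}\end{bmatrix}$ and $K_\circ^\perp$ is a matrix whose columns form a basis of the null space of $K_\circ$. Then the interconnected system is stable: there exists $\gamma$ such that for all trajectories of the interconnected system $$\forall T\ge 0,\qquad \int_0^T\|y(s)\|^2ds\le\gamma^2\int_0^T\|d(s)\|^2ds .$$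
   Context: Notation. $\mathbb{S}^k$ is the set of real symmetric $k\times k$ matrices; $\succ 0$ and $\prec 0$ mean positive and negative definite; $\|\cdot\|$ is the Euclidean norm; $\mathrm{col}$ denotes vertical stacking; $0_{a,b}$ is the $a\times b$ zero matrix and $0_n$ the $n\times n$ zero matrix. $L_{2e}$ is the space of locally square integrable signals on $[0,\infty)$; $H^m(0,1)$ is the usual Sobolev space. All matrices are real and of compatible dimensions. PDE. Let $m,l\ge 1$ be integers, $F_0,\dots,F_m\in\mathbb{R}^{l\times l}$ with $F_m\ne 0$. The PDE with state $z(x,t)\in\mathbb{R}^l$ is $$z_t(x,t)=\sum_{k=0}^m F_k\,\partial_x^{(k)}z(x,t),\quad x\in[0,1],\qquad z(\cdot,0)=0 .$$ Boundary values are collected in $\mathscr{B}_m(z)=\mathrm{col}\big(z(0),z(1),\dots,\partial_x^{(m-1)}z(0),\partial_x^{(m-1)}z(1)\big)\in\mathbb{R}^{2ml}$. For $y\in\mathbb{R}^p$ put $\mathscr{D}_y=\{z\in H^m(0,1): K_{\mathscr{B}}\mathscr{B}_m(z)=Ky\}$, where $K_{\mathscr{B}}\in\mathbb{R}^{ml\times 2ml}$ has full rank and $K\in\mathbb{R}^{ml\times p}$. Relation $\Delta$. Let $L\in\mathbb{R}^{r\times 2ml}$. A pair $(y,w)$ of $L_{2e}$ signals belongs to $\Delta$ if there is a solution $z\in C^1([0,\infty),H^m(0,1))$ of the PDE (with $z(\cdot,0)=0$) such that $z(\cdot,t)\in\mathscr{D}_{y(t)}$ and $w(t)=L\mathscr{B}_m(z(\cdot,t))$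 for all $t\ge0$. Interconnected system. $G$ is the LTI system $\dot X=AX+Bv$, $X(0)=0$, $y=CX+Dv$, with state, input, output dimensions $n,r,p$. The interconnected system is $v=w+d$, $(y,w)\in\Delta$, $y=Gv$, with external disturbance $d\in L_{2e}$, $d(t)\in\mathbb{R}^r$. A trajectory of the interconnected system consists of such signals together with the corresponding $z$ and $X$. Well-posedness of the interconnection is assumed throughout. Filter. $\Psi$ is the linear system (not required to be stable) $$\dot\xi=A_\Psi\xi+B_y y+B_{\mathscr{B}}\mathscr{B}_m(z),\quad \xi(0)=0,\qquad \psi=C_\Psi\xi+D_y y+D_{\mathscr{B}}\mathscr{B}_m(z),$$ with $\xi(t)\in\mathbb{R}^{n_\xi}$, $\psi(t)\in\mathbb{R}^{p_\psi}$. Finite horizon IQC with terminal cost. $M=M^\top$ defines a finite horizon IQC (integral quadratic constraint) with terminal cost $Z=Z^\top$ with respect to $\Psi$ if, for all trajectories of the PDE ($z(\cdot,0)=0$, $z(\cdot,t)\in\mathscr{D}_{y(t)}$) and of the filter, with any $y,\mathscr{B}_m(z)\in L_{2e}$, the inequality $\int_0^T\psi^\top M\psi\,dt+\xi(T)^\top Z\xi(T)\ge0$ holds for all $T\ge0$. Augmented matrices: $$\mathcal{A}=\begin{bmatrix}A_\Psi & B_yC\\0&A\end{bmatrix},\quad \mathcal{B}=\begin{bmatrix}B_yDL+B_{\mathscr{B}}\\ BL\end{bmatrix},\quad \mathcal{C}=\begin{bmatrix}C_\Psi & D_yC\end{bmatrix},\quad \mathcal{D}=D_yDL+D_{\mathscr{B}}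 .$$ *)

(* Defs.v *)
From HB Require Import structures.
From mathcomp Require Export all_boot all_order all_algebra.
From mathcomp Require Export all_classical all_reals all_analysis.
Export Order.TTheory GRing.Theory Num.Theory.
Export numFieldNormedType.Exports.

Set Implicit Arguments.
Unset Strict Implicit.
Unset Printing Implicit Defensive.

Local Open Scope classical_set_scope.
Local Open Scope ring_scope.

(* Squared Euclidean norm; the library norm `|u| on matrices is the sup norm. *)
Definition sqnorm (R : realType) (k : nat) (u : 'cV[R]_k) : R :=
  \sum_(i < k) u i 0 ^+ 2.

Definition quadform (R : realType) (k : nat) (Q : 'M[R]_k) (x : 'cV[R]_k) : R :=
  (x^T *m Q *m x) 0 0.

Definition posdef (R : realType) (k : nat) (Q : 'M[R]_k) : Prop :=
  Q^T = Q /\ forall x : 'cV[R]_k, x != 0 -> 0 < quadform Q x.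

Definition negdef (R : realType) (k : nat) (Q : 'M[R]_k) : Prop :=
  posdef (- Q).

Definition null_basis (R : realType) (a b q : nat)
    (K : 'M[R]_(a, b)) (N : 'M[R]_(b, q)) : Prop :=
  row_free N^T /\
  forall v : 'cV[R]_b, K *m v = 0 <-> exists c : 'cV[R]_q, v = N *m c.

(* Signals on [0, +oo[ are functions on R whose values at negative times are
   irrelevant. *)
Definition L2e (R : realType) (k : nat) (u : R -> 'cV[R]_k) : Prop :=
  (forall i, measurable_fun (`[0, +oo[ : set R) (fun t => u t i 0)) /\
  forall T : R, 0 <= T ->
    (\int[@lebesgue_measure R]_(t in `[0%R, T]) (sqnorm (u t))%:E < +oo)%E.

(* x' = f almost everywhere, x absolutely continuous and x(0) = 0. *)
Definition ode_solution (R : realType) (k : nat) (x f : R -> 'cV[R]_k) : Prop :=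
  forall (T : R) (i : 'I_k), 0 <= T ->
    (@lebesgue_measure R).-integrable `[0, T] (EFin \o (fun t => f t i 0)) /\
    x T i 0 = \int[@lebesgue_measure R]_(t in `[0, T]) f t i 0.

(* An element of H^m(0,1)^l is given by its jet u, where u k is the k-th
   derivative: for k < m the continuous representative on [0,1] (so that u k 0
   and u k 1 are the boundary values), absolutely continuous with derivative
   u k.+1; and u m square integrable, determined up to a null set.  The values
   u k x for k > m or x outside [0,1] are irrelevant. *)
Definition jet (R : realType) (l : nat) : Type := nat -> R -> 'cV[R]_l.

Definition Hm (R : realType) (m l : nat) (u : jet R l) : Prop :=
  [/\ forall i, measurable_fun (`[0, 1] : set R) (fun x => u m x i 0),
      (\int[@lebesgue_measure R]_(x in `[0%R, 1%R]) (sqnorm (u m x))%:E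
         < +oo)%E
    & forall (k : nat) (x : R) (i : 'I_l), (k < m)%N -> 0 <= x <= 1 ->
        u k x i 0 =
          u k 0 i 0 + \int[@lebesgue_measure R]_(s in `[0, x]) u k.+1 s i 0].

Definition Hm_sqnorm (R : realType) (m l : nat) (u : jet R l) : \bar R :=
  (\sum_(k < m.+1)
     \int[@lebesgue_measure R]_(x in `[0%R, 1%R]) (sqnorm (u k x))%:E)%E.

(* z is in C^1([0, +oo[, H^m(0,1)) with derivative zt; one-sided at t = 0. *)
Definition C1_Hm (R : realType) (m l : nat) (z zt : R -> jet R l) : Prop :=
  forall t : R, 0 <= t ->
    [/\ Hm m (z t), Hm m (zt t),
        Hm_sqnorm m (fun k x => h^-1 *: (z (t + h) k x - z t k x) - zt t k x)
          @[h --> within [set h : R | 0 <= t + h] (0^')] --> 0%E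
      & Hm_sqnorm m (fun k x => zt s k x - zt t k x)
          @[s --> within [set s : R | 0 <= s] (nbhs t)] --> 0%E].

Lemma bdim (m l : nat) : (\sum_(k < m) (l + l) = 2 * m * l)%N.
Proof. by rewrite sum_nat_const card_ord addnn -mul2n mulnCA mulnA. Qed.

(* col (u 0 0, u 0 1, u 1 0, u 1 1, ..., u m.-1 0, u m.-1 1) *)
Definition bvec (R : realType) (m l : nat) (u : jet R l) : 'cV[R]_(2 * m * l) :=
  castmx (bdim m l, erefl 1%N) (\mxcol_(k < m) col_mx (u k 0) (u k 1)).

Record pde (R : realType) (m l p r : nat) := Pde {
  pdeF : 'I_m.+1 -> 'M[R]_l;
  pdeKB : 'M[R]_(m * l, 2 * m * l);
  pdeK : 'M[R]_(m * l, p);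
  pdeL : 'M[R]_(r, 2 * m * l) }.

Record lti (R : realType) (n r p : nat) := Lti {
  ltiA : 'M[R]_n;
  ltiB : 'M[R]_(n, r);
  ltiC : 'M[R]_(p, n);
  ltiD : 'M[R]_(p, r) }.

(* nb is the dimension of the vector of boundary values. *)
Record filt (R : realType) (nxi p nb q : nat) := Filt {
  filtA : 'M[R]_nxi;
  filtBy : 'M[R]_(nxi, p);
  filtBb : 'M[R]_(nxi, nb);
  filtC : 'M[R]_(q, nxi);
  filtDy : 'M[R]_(q, p);
  filtDb : 'M[R]_(q, nb) }.

(* z_t = \sum_k F_k d_x^k z, an identity in L^2(0,1) for each t, and
   z(.,0) = 0. *)
Definition pde_solution (R : realType) (m l p r : nat) (S : pde R m l p r)
    (z : R -> jet R l) : Prop :=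
  (exists zt : R -> jet R l, C1_Hm m z zt /\
     forall t : R, 0 <= t ->
       {ae @lebesgue_measure R, forall x : R, 0 <= x <= 1 ->
          zt t 0%N x = \sum_(k < m.+1) pdeF S k *m z t k x}) /\
  forall x : R, 0 <= x <= 1 -> z 0 0%N x = 0.

(* The set D_y. *)
Definition pde_dom (R : realType) (m l p r : nat) (S : pde R m l p r)
    (y : 'cV[R]_p) (u : jet R l) : Prop :=
  Hm m u /\ pdeKB S *m bvec m u = pdeK S *m y.

Definition pde_trajectory (R : realType) (m l p r : nat) (S : pde R m l p r)
    (y : R -> 'cV[R]_p) (z : R -> jet R l) : Prop :=
  pde_solution S z /\ forall t : R, 0 <= t -> pde_dom S (y t) (z t).

(* (y, w) belongs to the relation Delta, as witnessed by z. *)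
Definition Delta_by (R : realType) (m l p r : nat) (S : pde R m l p r)
    (z : R -> jet R l) (y : R -> 'cV[R]_p) (w : R -> 'cV[R]_r) : Prop :=
  [/\ L2e y, L2e w, pde_trajectory S y z
    & forall t : R, 0 <= t -> w t = pdeL S *m bvec m (z t)].

(* Equalities between L_2e signals hold almost everywhere. *)
Definition trajectory (R : realType) (m l n r p : nat) (S : pde R m l p r)
    (G : lti R n r p) (d v w : R -> 'cV[R]_r) (y : R -> 'cV[R]_p)
    (z : R -> jet R l) (X : R -> 'cV[R]_n) : Prop :=
  [/\ L2e d /\ L2e v,
      {ae @lebesgue_measure R, forall t : R, 0 <= t -> v t = w t + d t},
      Delta_by S z y w,
      ode_solution X (fun t => ltiA G *m X t + ltiB G *m v t)
    & {ae @lebesgue_measure R, forall t : R, 0 <= t ->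
         y t = ltiC G *m X t + ltiD G *m v t}].

(* Every disturbance in L_2e produces exactly one trajectory: z and X are
   unique, and they determine v, w and y almost everywhere.  Since
   boundary values are continuous in time and the boundary condition holds for
   every t while d is only L_2e, existence for all d forces K D = 0: there is
   no direct feedthrough from v to the boundary condition. *)
Definition well_posed (R : realType) (m l n r p : nat) (S : pde R m l p r)
    (G : lti R n r p) : Prop :=
  (forall d : R -> 'cV[R]_r, L2e d ->
     exists v w y z X, trajectory S G d v w y z X) /\
  (forall (d v1 v2 w1 w2 : R -> 'cV[R]_r) (y1 y2 : R -> 'cV[R]_p)
     (z1 z2 : R -> jet R l) (X1 X2 : R -> 'cV[R]_n),
     trajectory S G d v1 w1 y1 z1 X1 -> trajectory S G d v2 w2 y2 z2 X2 ->
     forall t : R, 0 <= t ->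
       X1 t = X2 t /\ forall x : R, 0 <= x <= 1 -> z1 t 0%N x = z2 t 0%N x).

Definition filt_state (R : realType) (m l p nxi q : nat)
    (Psi : filt R nxi p (2 * m * l) q) (y : R -> 'cV[R]_p) (z : R -> jet R l)
    (xi : R -> 'cV[R]_nxi) : Prop :=
  ode_solution xi (fun t =>
    filtA Psi *m xi t + filtBy Psi *m y t + filtBb Psi *m bvec m (z t)).

Definition filt_out (R : realType) (m l p nxi q : nat)
    (Psi : filt R nxi p (2 * m * l) q) (y : R -> 'cV[R]_p) (z : R -> jet R l)
    (xi : R -> 'cV[R]_nxi) (t : R) : 'cV[R]_q :=
  filtC Psi *m xi t + filtDy Psi *m y t + filtDb Psi *m bvec m (z t).

Definition finite_horizon_IQC (R : realType) (m l p r nxi q : nat)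
    (S : pde R m l p r) (Psi : filt R nxi p (2 * m * l) q)
    (M : 'M[R]_q) (Z : 'M[R]_nxi) : Prop :=
  forall (y : R -> 'cV[R]_p) (z : R -> jet R l) (xi : R -> 'cV[R]_nxi),
    pde_trajectory S y z -> L2e y -> L2e (fun t => bvec m (z t)) ->
    filt_state Psi y z xi ->
    forall T : R, 0 <= T ->
      0 <= \int[@lebesgue_measure R]_(t in `[0, T])
             quadform M (filt_out Psi y z xi t)
           + quadform Z (xi T).

Section Augmented.
Variables (R : realType) (m l n r p nxi q : nat).
Variables (S : pde R m l p r) (G : lti R n r p).
Variable Psi : filt R nxi p (2 * m * l) q.

Definition augA : 'M[R]_(nxi + n) :=
  block_mx (filtA Psi) (filtBy Psi *m ltiC G) 0 (ltiA G).

Definition augB : 'M[R]_(nxi + n, 2 * m * l) :=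
  col_mx (filtBy Psi *m ltiD G *m pdeL S + filtBb Psi) (ltiB G *m pdeL S).

Definition augC : 'M[R]_(q, nxi + n) :=
  row_mx (filtC Psi) (filtDy Psi *m ltiC G).

Definition augD : 'M[R]_(q, 2 * m * l) :=
  filtDy Psi *m ltiD G *m pdeL S + filtDb Psi.

(* [I 0; A B; C D] *)
Definition outer : 'M[R]_((nxi + n) + ((nxi + n) + q), (nxi + n) + 2 * m * l) :=
  col_mx (row_mx 1%:M 0) (col_mx (row_mx augA augB) (row_mx augC augD)).

(* [0 P 0; P 0 0; 0 0 M] *)
Definition middle (P : 'M[R]_(nxi + n)) (M : 'M[R]_q) :
    'M[R]_((nxi + n) + ((nxi + n) + q)) :=
  block_mx 0 (row_mx P 0) (col_mx P 0) (block_mx 0 0 0 M).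

(* [0 KC -K_B] *)
Definition Kcirc : 'M[R]_(m * l, (nxi + n) + 2 * m * l) :=
  row_mx (row_mx 0 (pdeK S *m ltiC G)) (- pdeKB S).

End Augmented.

Arguments Kcirc {R m l n r p} nxi S G.

(* Main.v *)
Require Import Defs.
From mathcomp Require Import measurable_realfun ring lra.

Set Implicit Arguments.
Unset Strict Implicit.
Unset Printing Implicit Defensive.

Local Open Scope classical_set_scope.
Local Open Scope ring_scope.

(** The storage function is V = Y^T P Y, where Y = col(xi, X) stacks the filter
and plant states.  Well-posedness forces K D = 0, because the boundary values
are continuous in time whereas K D d is only as regular as d; hence
col(xi, X, B_m(z)) lies in the null space of K_circ almost everywhere.  There
the strict matrix inequality, perturbed by d and absorbed with Young's
inequality, reads V' + psi^T M psi + delta |y|^2 <= kappa |d|^2.  Integrating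
over [0, T], the constraint bounds the psi-term below by - xi(T)^T Z xi(T) and
P > diag(Z, 0) makes V(T) - xi(T)^T Z xi(T) nonnegative, so gamma^2 =
kappa / delta.  The chain rule for V holds for absolutely continuous states by
Fubini's theorem on the triangle s <= t. *)

(** * Quadratic forms and the pointwise dissipation inequality *)

(** The constraint speaks of PDE and filter trajectories, whereas a closed-loop trajectory carries
    no filter state and its boundary values are not given as a signal in L_2e. Both must be
    produced. The boundary values are shown to be continuous in time, by a trace estimate on [0,1]
    applied to difference quotients in H^m. The filter state is built by Picard iteration, since its
    forcing is only locally integrable; an unstable A_Psi does no harm, because every estimate lives
    on a fixed [0,T]. P itself has no sign, so V need not be nonnegative: only after the terminal
    cost is subtracted does its value at T have a sign. The room for delta |y|^2 comes from
    coercivity: on the null space, written as the range of [Kperp], the strict inequality leaves a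
    margin e |c|^2 in the coordinates c, shared by the cross terms with d and by the output. Since e
    depends on the matrices alone, so do kappa and delta, and gamma is uniform over trajectories and
    T. *)

Section QuadraticForms.
Variable R : realType.

Definition bilin (a b : nat) (A : 'M[R]_(a, b)) (u : 'cV[R]_a) (v : 'cV[R]_b) : R :=
  (u^T *m A *m v) 0 0.

Lemma quadformE (k : nat) (Q : 'M[R]_k) x : quadform Q x = bilin Q x x.
Proof. by []. Qed.

Lemma bilinDl (a b : nat) (A : 'M[R]_(a, b)) u1 u2 v :
  bilin A (u1 + u2) v = bilin A u1 v + bilin A u2 v.
Proof. by rewrite /bilin raddfD /= !mulmxDl mxE. Qed.

Lemma bilinDr (a b : nat) (A : 'M[R]_(a, b)) u v1 v2 :
  bilin A u (v1 + v2) = bilin A u v1 + bilin A u v2.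
Proof. by rewrite /bilin !mulmxDr mxE. Qed.

Lemma bilinZl (a b : nat) (A : 'M[R]_(a, b)) c u v :
  bilin A (c *: u) v = c * bilin A u v.
Proof. by rewrite /bilin linearZ /= -!scalemxAl mxE. Qed.

Lemma bilinZr (a b : nat) (A : 'M[R]_(a, b)) c u v :
  bilin A u (c *: v) = c * bilin A u v.
Proof. by rewrite /bilin -!scalemxAr mxE. Qed.

Lemma bilin_tr (a b : nat) (A : 'M[R]_(a, b)) u v : bilin A^T v u = bilin A u v.
Proof.
by rewrite /bilin -[in RHS](trmxK (_ *m v)) [RHS]mxE !trmx_mul trmxK mulmxA.
Qed.

Lemma bilin_mul (a b a' b' : nat) (A : 'M[R]_(a, b)) (B : 'M[R]_(a, a'))
    (C : 'M[R]_(b, b')) u v :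
  bilin A (B *m u) (C *m v) = bilin (B^T *m A *m C) u v.
Proof. by rewrite /bilin trmx_mul !mulmxA. Qed.

Lemma bilin_addmx (a b : nat) (A B : 'M[R]_(a, b)) u v :
  bilin (A + B) u v = bilin A u v + bilin B u v.
Proof. by rewrite /bilin mulmxDr mulmxDl mxE. Qed.

Lemma bilin_sum (a b : nat) (A : 'M[R]_(a, b)) u v :
  bilin A u v = \sum_i \sum_j A i j * (u i 0 * v j 0).
Proof.
rewrite /bilin mxE exchange_big /=; apply: eq_bigr => j _.
rewrite mxE mulr_suml; apply: eq_bigr => i _; rewrite mxE; ring.
Qed.

Lemma sqnorm_bilin (k : nat) (u : 'cV[R]_k) : sqnorm u = bilin 1%:M u u.
Proof.
by rewrite /bilin mulmx1 mxE; apply: eq_bigr => i _; rewrite mxE expr2.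
Qed.

Lemma sqnorm_ge0 (k : nat) (u : 'cV[R]_k) : 0 <= sqnorm u.
Proof. by apply: sumr_ge0 => i _; exact: sqr_ge0. Qed.

Lemma sqnorm_eq0 (k : nat) (u : 'cV[R]_k) : sqnorm u = 0 -> u = 0.
Proof.
move/eqP; rewrite psumr_eq0 => [/allP u0|i _]; last exact: sqr_ge0.
apply/matrixP => i j; rewrite ord1 mxE; apply/eqP.
by have := u0 i; rewrite mem_index_enum sqrf_eq0 implyTb => /(_ isT).
Qed.

Lemma sqnormD_le (k : nat) (u v : 'cV[R]_k) :
  sqnorm (u + v) <= 2 * (sqnorm u + sqnorm v).
Proof.
rewrite -big_split mulr_sumr; apply: ler_sum => i _ /=; rewrite mxE.
have := sqr_ge0 (u i 0 - v i 0); nra.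
Qed.

(** The form is evaluated at Q(y,y) x - Q(x,y) y, the part of x that is Q-orthogonal to y, scaled to
    avoid a division. *)
Lemma posdef_CS (k : nat) (Q : 'M[R]_k) x y : posdef Q ->
  bilin Q x y ^+ 2 <= bilin Q x x * bilin Q y y.
Proof.
move=> [sQ pQ]; have [->|y0] := eqVneq y 0.
  by rewrite /bilin !mulmx0 mxE expr0n mulr0.
have Qy := pQ _ y0; rewrite quadformE in Qy.
have Qge0 z : 0 <= bilin Q z z.
  have [->|/pQ/ltW//] := eqVneq z 0; by rewrite /bilin !mulmx0 mxE.
have := Qge0 (bilin Q y y *: x - bilin Q x y *: y).
rewrite -scaleNr !(bilinDl, bilinDr, bilinZl, bilinZr).
have -> : bilin Q y x = bilin Q x y by rewrite -[in LHS]sQ bilin_tr.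
set a := bilin Q x x; set b := bilin Q x y; set c := bilin Q y y in Qy *.
move=> H; have : 0 <= c * (c * a - b ^+ 2) by nra.
by rewrite pmulr_rge0// subr_ge0 mulrC.
Qed.

Lemma posdef1 (k : nat) : posdef (1%:M : 'M[R]_k).
Proof.
split=> [|x x0]; first exact: trmx1.
rewrite quadformE -sqnorm_bilin lt_def sqnorm_ge0 andbT.
by apply: contra_neq x0; exact: sqnorm_eq0.
Qed.

Lemma posdef_unit (k : nat) (Q : 'M[R]_k) : posdef Q -> Q \in unitmx.
Proof.
move=> [sQ pQ]; rewrite -row_free_unit -kermx_eq0; apply/negPn/negP.
move=> /rowV0Pn[v /sub_kermxP vQ v0].
have := pQ v^T; rewrite trmx_eq0 => /(_ v0).
by rewrite /quadform trmxK vQ mul0mx mxE ltxx.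
Qed.

(* Cauchy-Schwarz for Q applied to x_i = x^T Q (Q^-1 e_i). *)
Lemma posdef_coercive (k : nat) (Q : 'M[R]_k) : posdef Q ->
  exists2 e, 0 < e & forall x, e * sqnorm x <= quadform Q x.
Proof.
move=> pQ; have uQ := posdef_unit pQ.
pose w i := invmx Q *m delta_mx i (0 : 'I_1).
pose c := \sum_i bilin Q (w i) (w i).
have Qge0 z : 0 <= bilin Q z z.
  have [->|/(proj2 pQ)/ltW//] := eqVneq z 0; by rewrite /bilin !mulmx0 mxE.
have c0 : 0 <= c by apply: sumr_ge0.
(* The bound obtained is [sqnorm x <= c * quadform Q x]; adding 1 keeps the constant invertible in
   dimension 0, where [c = 0]. *)
exists (1 + c)^-1; first by rewrite invr_gt0; lra.
move=> x; rewrite mulrC ler_pdivrMr; last by lra.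
rewrite quadformE.
suff : sqnorm x <= bilin Q x x * c by have := Qge0 x; nra.
rewrite mulr_sumr; apply: ler_sum => i _.
apply: le_trans (posdef_CS _ _ pQ).
rewrite /bilin /w mulmxA -(mulmxA x^T) mulmxV// mulmx1.
by rewrite -colE !mxE.
Qed.

(** The constant is the squared Frobenius norm of A, by Cauchy-Schwarz on each row. *)
Lemma sqnorm_mul_le (a b : nat) (A : 'M[R]_(a, b)) :
  exists2 c, 0 <= c & forall x, sqnorm (A *m x) <= c * sqnorm x.
Proof.
exists (\sum_i sqnorm (row i A)^T).
  by apply: sumr_ge0 => i _; exact: sqnorm_ge0.
move=> x; rewrite mulr_suml; apply: ler_sum => i _.
have := posdef_CS (row i A)^T x (posdef1 b).
rewrite -!sqnorm_bilin /bilin mulmx1 trmxK.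
suff -> : (A *m x) i 0 = (row i A *m x) 0 0 by [].
by rewrite -row_mul [RHS]mxE.
Qed.

(** Expanding tau (x - y / tau)^2 >= 0 in each coordinate, with y = A v. The weight on the first
    argument is free, so that it can be made a fraction of the coercivity margin. *)
Lemma bilin_young (a b : nat) (A : 'M[R]_(a, b)) (tau : R) : 0 < tau ->
  exists2 c, 0 <= c &
    forall u v, 2 * bilin A u v <= tau * sqnorm u + c * sqnorm v.
Proof.
move=> t0; have [c c0 Ac] := sqnorm_mul_le A.
exists (tau^-1 * c) => [|u v]; first by rewrite mulr_ge0// invr_ge0 ltW.
apply: (@le_trans _ _ (tau * sqnorm u + tau^-1 * sqnorm (A *m v))); last first.
  by rewrite lerD2l -mulrA ler_pM2l ?invr_gt0.
rewrite /bilin -mulmxA mxE !mulr_sumr -big_split; apply: ler_sum => i _ /=.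
rewrite [u^T _ _]mxE; set x := u i 0; set y := (A *m v) i 0.
have := mulr_ge0 (ltW t0) (sqr_ge0 (x - tau^-1 * y)).
have -> : tau * (x - tau^-1 * y) ^+ 2
  = tau * x ^+ 2 + tau^-1 * y ^+ 2 - 2 * (x * y) by field; rewrite gt_eqF.
by rewrite subr_ge0.
Qed.

End QuadraticForms.

(** * The matrix inequality under a disturbance *)

Section Dissipation.
Variables (R : realType) (m l n r p nxi q nperp : nat).
Variables (S : pde R m l p r) (G : lti R n r p).
Variables (Psi : filt R nxi p (2 * m * l) q).
Variables (P : 'M[R]_(nxi + n)) (M : 'M[R]_q).

(** The disturbance enters through v = L b + d: the terms in b are already in [augB] and [augD],
    while those in d form the input matrix [augE] of the state and the feedthrough [augF] of the
    filter output. *)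
Definition augE : 'M[R]_(nxi + n, r) :=
  col_mx (filtBy Psi *m ltiD G) (ltiB G).

Definition augF : 'M[R]_(q, r) := filtDy Psi *m ltiD G.

(** The form of the matrix inequality is V' + psi^T M psi along the undisturbed augmented system;
    symmetry of P merges the two off-diagonal terms. *)
Lemma quadform_outer (Y : 'cV[R]_(nxi + n)) (b : 'cV[R]_(2 * m * l)) :
  P^T = P ->
  quadform ((outer S G Psi)^T *m middle P M *m outer S G Psi) (col_mx Y b)
  = 2 * bilin P Y (augA G Psi *m Y + augB S G Psi *m b)
    + quadform M (augC G Psi *m Y + augD S G Psi *m b).
Proof.
move=> sP; rewrite !quadformE -bilin_mul.
set g := augA _ _ *m _ + _; set h := augC _ _ *m _ + _.
have -> : outer S G Psi *m col_mx Y b = col_mx Y (col_mx g h).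
  rewrite /outer mul_col_mx mul_row_col mul1mx mul0mx addr0 mul_col_mx.
  by rewrite !mul_row_col.
rewrite /bilin -mulmxA.
have -> : middle P M *m col_mx Y (col_mx g h)
    = col_mx (P *m g) (col_mx (P *m Y) (M *m h)).
  rewrite /middle mul_block_col mul_row_col !mul0mx mul_col_mx mul_block_col.
  by rewrite !mul0mx !add0r addr0 add_col_mx addr0 add0r.
rewrite !tr_col_mx !mul_row_col [LHS]mxE [in X in _ + X]mxE !mulmxA.
rewrite -!/(bilin _ _ _) addrA.
rewrite -[bilin P g Y]bilin_tr sP; ring.
Qed.

Variable Kperp : 'M[R]_((nxi + n) + 2 * m * l, nperp).
Hypothesis symP : P^T = P.
Hypothesis hKperp : null_basis (Kcirc nxi S G) Kperp.
Hypothesis hLMI : negdef (Kperp^T *m (outer S G Psi)^T *m middle P M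
                    *m outer S G Psi *m Kperp).

(** The margin e |c|^2 is spent in thirds: one absorbs the terms mixing c and d, one pays for the
    output, and the last is left over. Everything else is quadratic in d and goes into [kap]. *)
Lemma dissipation : M^T = M -> exists del kap, [/\ 0 < del, 0 <= kap &
  forall (xi : 'cV[R]_nxi) (X : 'cV[R]_n) (b : 'cV[R]_(2 * m * l))
      (d v : 'cV[R]_r) (y : 'cV[R]_p),
    pdeKB S *m b = pdeK S *m ltiC G *m X ->
    v = pdeL S *m b + d -> y = ltiC G *m X + ltiD G *m v ->
    2 * bilin P (col_mx xi X)
          (augA G Psi *m col_mx xi X + augB S G Psi *m b + augE *m d)
    + quadform M (augC G Psi *m col_mx xi X + augD S G Psi *m b + augF *m d)
    + del * sqnorm y <= kap * sqnorm d].
Proof.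
move=> symM; have [e e0 coer] := posdef_coercive hLMI.
have e3 : 0 < e / 3 by rewrite divr_gt0.
pose KY := usubmx Kperp; pose Kb := dsubmx Kperp.
(* In the coordinates c, the undisturbed filter output is [Kp *m c], the plant state [KX *m c], and
   the undisturbed plant output [H *m c]. *)
pose Kp := augC G Psi *m KY + augD S G Psi *m Kb.
pose KX := dsubmx KY.
pose H := ltiC G *m KX + ltiD G *m (pdeL S *m Kb).
(* The terms mixing c and d come from both the storage and the multiplier, so one matrix collects
   them. *)
have [c1 c10 young] := bilin_young (KY^T *m P *m augE + Kp^T *m M *m augF) e3.
have [c2 c20 Hle] := sqnorm_mul_le H.
have [c3 c30 Dle] := sqnorm_mul_le (ltiD G).
have [c4 c40 Fle] := bilin_young (augF^T *m M *m augF) ltr01.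
(* Since |y|^2 <= 2 (c2 |c|^2 + c3 |d|^2), this gives 2 del c2 <= e / 3; the 1 covers [c2 = 0]. *)
pose del := e / (6 * (c2 + 1)).
have del0 : 0 < del by rewrite divr_gt0// mulr_gt0//; lra.
exists del, (c1 + (1 + c4) + 2 * del * c3); split=> //.
  by apply: addr_ge0; [lra | apply: mulr_ge0 => //; lra].
move=> xi X b d v y Kb0 vE yE'; set Y := col_mx xi X.
have [c Yc] : exists c, col_mx Y b = Kperp *m c.
  apply/(proj2 hKperp); rewrite /Kcirc mul_row_col /Y mul_row_col mul0mx add0r.
  by rewrite mulNmx Kb0 subrr.
have YE : Y = KY *m c by rewrite mul_usub_mx -Yc col_mxKu.
have bE : b = Kb *m c by rewrite mul_dsub_mx -Yc col_mxKd.
have XE : X = KX *m c by rewrite mul_dsub_mx -YE col_mxKd.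
have LMIc : e * sqnorm c <= - bilin (Kperp^T *m (outer S G Psi)^T *m
    middle P M *m outer S G Psi *m Kperp) c c.
  by have := coer c; rewrite quadformE /bilin mulmxN mulNmx mxE.
move: LMIc; have := quadform_outer Y b symP.
rewrite Yc quadformE bilin_mul !mulmxA => ->.
set g := augA _ _ *m _ + _; set h := augC _ _ *m _ + _; rewrite quadformE => LMIc.
have hE : h = Kp *m c by rewrite /h YE bE !mulmxA -mulmxDl.
have yE : y = H *m c + ltiD G *m d.
  by rewrite yE' vE XE bE mulmxDr /H mulmxDl !mulmxA addrA.
have := young c d; rewrite bilin_addmx -!bilin_mul -YE -hE => youngcd.
have := Fle d d; rewrite -bilin_mul => Fd.
have := sqnormD_le (H *m c) (ltiD G *m d); rewrite -yE => yle.
have Hc := Hle c; have Dd := Dle d.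
rewrite bilinDr quadformE [bilin M (h + _) _]bilinDl !(bilinDr M _ h).
have -> : bilin M (augF *m d) h = bilin M h (augF *m d).
  by rewrite -[in LHS]symM bilin_tr.
have dely : del * sqnorm y <= 2 * del * (c2 * sqnorm c + c3 * sqnorm d).
  rewrite [2 * del]mulrC -[del * 2 * _]mulrA ler_pM2l//; lra.
have : 2 * del * c2 * sqnorm c <= e / 3 * sqnorm c.
  rewrite ler_wpM2r ?sqnorm_ge0// /del.
  rewrite -[2 * _ * _]mulrA [_ / _ * _]mulrAC mulrA ler_pdivrMr; last by lra.
  nra.
have : 0 <= c4 * sqnorm d by rewrite mulr_ge0 ?sqnorm_ge0.
have : 0 <= e * sqnorm c by rewrite mulr_ge0 ?sqnorm_ge0 ?ltW.
by have := sqnorm_ge0 d; lra.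
Qed.

End Dissipation.

(** * Square integrable functions and primitives *)

Section Integration.
Variable R : realType.
Notation mu := (@lebesgue_measure R).
Implicit Types (D : set (measurableTypeR R)) (f g : R -> R).

Lemma integrable_measurable D f :
  mu.-integrable D (EFin \o f) -> measurable_fun D f.
Proof. by move=> /measurable_int/measurable_EFinP. Qed.

Lemma le_integrable_real D f g : measurable D -> measurable_fun D f ->
  mu.-integrable D (EFin \o g) -> (forall x, D x -> `|f x| <= g x) ->
  mu.-integrable D (EFin \o f).
Proof.
move=> mD mf ig fg; apply: le_integrable ig => //; first exact/measurable_EFinP.
by move=> x Dx /=; rewrite lee_fin (le_trans (fg _ Dx))// ler_norm.
Qed.

Lemma eq_integrable_real D f g : measurable D -> {in D, f =1 g} ->
  mu.-integrable D (EFin \o f) -> mu.-integrable D (EFin \o g).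
Proof. by move=> mD fg; apply: eq_integrable => // x xD /=; rewrite fg. Qed.

Lemma integrableD_real D f g : measurable D ->
  mu.-integrable D (EFin \o f) -> mu.-integrable D (EFin \o g) ->
  mu.-integrable D (EFin \o (fun x => f x + g x)).
Proof.
by move=> mD fi gi; exact: (@integrableD _ _ _ mu _ _ (EFin \o f) (EFin \o g)).
Qed.

Lemma integrableZl_real D f c : measurable D ->
  mu.-integrable D (EFin \o f) -> mu.-integrable D (EFin \o (fun x => c * f x)).
Proof. by move=> mD fi; exact: (@integrableZl _ _ _ mu _ _ _ (EFin \o f)). Qed.

Lemma integrable_sum_real D I (s : seq I) (F : I -> R -> R) : measurable D ->
  (forall i, mu.-integrable D (EFin \o F i)) ->
  mu.-integrable D (EFin \o (fun x => \sum_(i <- s) F i x)).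
Proof.
move=> mD Fi; have Fi' : mu.-integrable D (fun x => \sum_(i <- s) (F i x)%:E)%E.
  exact: (@integrable_sum _ _ _ mu D mD _ s xpredT (fun i x => (F i x)%:E)
    (fun i _ => Fi i)).
by apply: eq_integrable Fi' => // x _ /=; rewrite sumEFin.
Qed.

Lemma integrable_mulmx D a b (A : 'M[R]_(a, b)) (u : R -> 'cV[R]_b) :
  measurable D -> (forall j, mu.-integrable D (EFin \o (fun t => u t j 0))) ->
  forall i, mu.-integrable D (EFin \o (fun t => (A *m u t) i 0)).
Proof.
move=> mD ui i.
apply: (@eq_integrable_real _ (fun t => \sum_j A i j * u t j 0)) => //.
  by move=> x _; rewrite mxE.
by apply: integrable_sum_real => // j; exact: integrableZl_real.
Qed.

Lemma Rintegral_sum D I (s : seq I) (F : I -> R -> R) : measurable D ->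
  (forall i, mu.-integrable D (EFin \o F i)) ->
  \int[mu]_(x in D) (\sum_(i <- s) F i x) =
  \sum_(i <- s) \int[mu]_(x in D) F i x.
Proof.
move=> mD Fi; elim: s => [|i s IH].
  by rewrite big_nil; under eq_Rintegral do rewrite big_nil;
    rewrite Rintegral_cst// mul0r.
rewrite big_cons -IH -RintegralD//; last exact: integrable_sum_real.
by apply: eq_Rintegral => x _; rewrite big_cons.
Qed.

Lemma ae_eq_Rintegral D f g : measurable D ->
  measurable_fun D f -> measurable_fun D g ->
  {ae mu, forall x, D x -> f x = g x} ->
  \int[mu]_(x in D) f x = \int[mu]_(x in D) g x.
Proof.
move=> mD mf mg fg; congr fine; apply: ae_eq_integral => //.
- exact/measurable_EFinP.
- exact/measurable_EFinP.
- by apply: filterS fg => x fgx Dx; rewrite fgx.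
Qed.

(** The difference g - f agrees almost everywhere with its absolute value, whose integral is
    nonnegative. *)
Lemma ae_le_Rintegral D f g : measurable D ->
  mu.-integrable D (EFin \o f) -> mu.-integrable D (EFin \o g) ->
  {ae mu, forall x, D x -> f x <= g x} ->
  \int[mu]_(x in D) f x <= \int[mu]_(x in D) g x.
Proof.
move=> mD fi gi fg; rewrite -subr_ge0 -RintegralB//.
have mgf : measurable_fun D (fun x => g x - f x).
  by apply: measurable_funB; exact: integrable_measurable.
rewrite (@ae_eq_Rintegral _ _ (fun x => `|g x - f x|))//.
- by apply: Rintegral_ge0.
- exact: measurableT_comp.
- by apply: filterS fg => x fgx Dx; rewrite ger0_norm// subr_ge0 fgx.
Qed.

(** Measurability is listed separately, because that of the square does not imply that of f. *)
Definition sqint D f :=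
  measurable_fun D f /\ mu.-integrable D (EFin \o (fun t => f t ^+ 2)).

Lemma sqintM D f g : measurable D -> sqint D f -> sqint D g ->
  mu.-integrable D (EFin \o (fun t => f t * g t)).
Proof.
move=> mD [mf f2] [mg g2].
apply: (@le_integrable_real _ _ (fun t => f t ^+ 2 + g t ^+ 2)) => //.
- exact: measurable_funM.
- exact: integrableD_real.
move=> x _; rewrite ler_norml; apply/andP; split.
  by have := sqr_ge0 (f x + g x); have := sqr_ge0 (f x); have := sqr_ge0 (g x); nra.
by have := sqr_ge0 (f x - g x); have := sqr_ge0 (f x); have := sqr_ge0 (g x); nra.
Qed.

Lemma sqintD D f g : measurable D -> sqint D f -> sqint D g ->
  sqint D (fun t => f t + g t).
Proof.
move=> mD sf sg; split; first by apply: measurable_funD; [case: sf|case: sg].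
apply: (@eq_integrable_real _
  (fun t => f t * f t + (2 * (f t * g t) + g t * g t))) => //.
  by move=> t _; ring.
apply: integrableD_real => //; first exact: sqintM.
by apply: integrableD_real => //; [apply: integrableZl_real => //|]; exact: sqintM.
Qed.

Lemma sqintZ D f c : measurable D -> sqint D f -> sqint D (fun t => c * f t).
Proof.
move=> mD [mf f2]; split; first exact: measurable_funM.
apply: (@eq_integrable_real _ (fun t => c ^+ 2 * f t ^+ 2)) => //.
  by move=> t _; ring.
exact: integrableZl_real.
Qed.

Lemma sqint_sum D I (s : seq I) (F : I -> R -> R) : measurable D ->
  (forall i, sqint D (F i)) -> sqint D (fun x => \sum_(i <- s) F i x).
Proof.
move=> mD Fi; elim: s => [|i s IH].
  rewrite (_ : (fun _ => _) = cst 0); last by apply/funext => x; rewrite big_nil.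
  split=> //; apply: eq_integrable (integrable0 _ _) => // x _ /=.
  by rewrite expr0n.
rewrite (_ : (fun _ => _) = (fun x => F i x + \sum_(i <- s) F i x)).
  exact: sqintD.
by apply/funext => x; rewrite big_cons.
Qed.

Lemma eq_sqint D f g : measurable D -> {in D, f =1 g} -> sqint D f -> sqint D g.
Proof.
move=> mD fg [mf f2]; split; first exact: eq_measurable_fun mf.
by apply: eq_integrable f2 => // x xD /=; rewrite fg.
Qed.

Lemma sqint_mulmx D a b (A : 'M[R]_(a, b)) (u : R -> 'cV[R]_b) :
  measurable D -> (forall j, sqint D (fun t => u t j 0)) ->
  forall i, sqint D (fun t => (A *m u t) i 0).
Proof.
move=> mD ui i; apply: (@eq_sqint _ (fun t => \sum_j A i j * u t j 0)) => //.
  by move=> x _; rewrite mxE.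
by apply: sqint_sum => // j; exact: sqintZ.
Qed.

Lemma bounded_integrable D f (c : R) : measurable D -> (mu D < +oo)%E ->
  measurable_fun D f -> (forall x, D x -> `|f x| <= c) ->
  mu.-integrable D (EFin \o f).
Proof.
move=> mD fD mf fc; apply: measurable_bounded_integrable => //.
exists c; split=> [|e ce x Dx]; first exact: num_real.
by rewrite /= (le_trans (fc _ Dx))// ltW.
Qed.

Lemma bounded_sqint D f (c : R) : measurable D -> (mu D < +oo)%E ->
  measurable_fun D f -> (forall x, D x -> `|f x| <= c) -> sqint D f.
Proof.
move=> mD fD mf fc; split=> //.
apply: (@bounded_integrable _ _ (c ^+ 2)) => //; first exact: measurable_funX.
move=> x Dx; have := fc _ Dx; rewrite normrX => fxc.
by rewrite ler_pXn2r// nnegrE// (le_trans _ fxc).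
Qed.

Lemma sqint_integrable D f : measurable D -> (mu D < +oo)%E -> sqint D f ->
  mu.-integrable D (EFin \o f).
Proof.
move=> mD fD sf; apply: (@eq_integrable_real _ (fun t => 1 * f t)) => //.
  by move=> x _; rewrite mul1r.
apply: sqintM => //; apply: (@bounded_sqint _ _ 1) => // x _.
by rewrite normr1.
Qed.

Lemma lebesgue_itv_finite (a b : R) : (mu `[a, b] < +oo)%E.
Proof. by rewrite lebesgue_measure_itv /=; case: ifP => _; rewrite ?ltry. Qed.

Lemma integrable_sqnorm_coord D k (u : R -> 'cV[R]_k) : measurable D ->
  (forall i, measurable_fun D (fun t => u t i 0)) ->
  (\int[mu]_(t in D) (sqnorm (u t))%:E < +oo)%E ->
  forall i, sqint D (fun t => u t i 0).
Proof.
move=> mD um ufin i; split=> //.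
have msq : measurable_fun D (fun t => sqnorm (u t)).
  by apply: measurable_sum => j; exact: measurable_funX.
have : mu.-integrable D (EFin \o (fun t => sqnorm (u t))).
  apply/integrableP; split; first exact/measurable_EFinP.
  apply: le_lt_trans ufin; apply: ge0_le_integral => //=.
  - by apply/measurable_EFinP/measurableT_comp.
  - exact/measurable_EFinP.
  - by move=> x _; rewrite lee_fin ger0_norm// sqnorm_ge0.
move=> h; apply: le_integrable_real h _ => //; first exact: measurable_funX.
move=> x _; rewrite normrX real_normK ?num_real// /sqnorm (bigD1 i)//= lerDl.
by apply: sumr_ge0 => j _; exact: sqr_ge0.
Qed.

Lemma sqint_sqnorm D k (u : R -> 'cV[R]_k) : measurable D ->
  (forall i, sqint D (fun t => u t i 0)) ->
  mu.-integrable D (EFin \o (fun t => sqnorm (u t))).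
Proof.
by move=> mD su; apply: integrable_sum_real => // i; case: (su i).
Qed.

Lemma sqint_bilin D a b (A : 'M[R]_(a, b)) (u : R -> 'cV[R]_a)
    (v : R -> 'cV[R]_b) : measurable D ->
  (forall i, sqint D (fun t => u t i 0)) ->
  (forall i, sqint D (fun t => v t i 0)) ->
  mu.-integrable D (EFin \o (fun t => bilin A (u t) (v t))).
Proof.
move=> mD su sv.
apply: (@eq_integrable_real _
  (fun t => \sum_i \sum_j A i j * (u t i 0 * v t j 0))) => //.
  by move=> x _; rewrite bilin_sum.
do 2 (apply: integrable_sum_real => // ?).
by apply: integrableZl_real => //; exact: sqintM.
Qed.

Lemma L2e_sqint k (u : R -> 'cV[R]_k) (T : R) : 0 <= T -> L2e u ->
  forall i, sqint `[0, T] (fun t => u t i 0).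
Proof.
move=> T0 [um fu]; apply: integrable_sqnorm_coord => //; last exact: fu.
move=> i; apply: measurable_funS (um i) => //.
by apply: subset_itvl; rewrite bnd_simp.
Qed.

Lemma sqint_L2e k (u : R -> 'cV[R]_k) :
  (forall i, measurable_fun (`[0, +oo[ : set R) (fun t => u t i 0)) ->
  (forall (T : R) i, 0 <= T -> sqint `[0, T] (fun t => u t i 0)) -> L2e u.
Proof.
move=> um su; split=> // T T0.
have /integrableP[_] : mu.-integrable `[0, T] (EFin \o (fun t => sqnorm (u t))).
  by apply: sqint_sqnorm => // i; exact: su.
congr (_ < _)%E; apply: eq_integral => x _ /=.
by rewrite ger0_norm// sqnorm_ge0.
Qed.

End Integration.

(** * Primitives of integrable functions *)

Section Primitive.
Variable R : realType.
Notation mu := (@lebesgue_measure R).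
Variables (T : R).
Hypothesis T0 : 0 <= T.
Implicit Types (f g : R -> R).

Lemma integrable_le f t : mu.-integrable `[0, T] (EFin \o f) -> t <= T ->
  mu.-integrable `[0, t] (EFin \o f).
Proof.
by move=> fi tT; apply: integrableS fi => //; apply: subset_itvl; rewrite bnd_simp.
Qed.

Definition prim f (t : R) : R := \int[mu]_(s in `[0, t]) f s.

Lemma prim_cont f : mu.-integrable `[0, T] (EFin \o f) ->
  {within `[0, T], continuous (prim f)}.
Proof. exact: parameterized_integral_continuous. Qed.

Lemma prim_measurable f : mu.-integrable `[0, T] (EFin \o f) ->
  measurable_fun `[0, T] (prim f).
Proof.
by move=> fi; apply: subspace_continuous_measurable_fun => //; exact: prim_cont.
Qed.

Lemma prim_le f t : mu.-integrable `[0, T] (EFin \o f) -> t <= T ->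
  `|prim f t| <= \int[mu]_(s in `[0, T]) `|f s|.
Proof.
move=> fi tT; have fit := integrable_le fi tT.
apply: le_trans (le_normr_Rintegral _ fit) _ => //.
rewrite /Rintegral fine_le//.
- by apply: integrable_fin_num => //; exact: integrable_norm fit.
- by apply: integrable_fin_num => //; exact: integrable_norm fi.
- apply: ge0_subset_integral => //=.
    exact: measurable_int (integrable_norm fi).
  by apply: subset_itvl; rewrite bnd_simp.
Qed.

(** A primitive is bounded by the L^1 norm of its integrand, so integrability of g suffices to
    dominate the product. *)
Lemma integrable_primM f g : mu.-integrable `[0, T] (EFin \o f) ->
  mu.-integrable `[0, T] (EFin \o g) ->
  mu.-integrable `[0, T] (EFin \o (fun t => prim f t * g t)).
Proof.
move=> fi gi.
apply: (@le_integrable_real _ _ _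
  (fun t => (\int[mu]_(s in `[0, T]) `|f s|) * `|g t|)) => //.
- apply: measurable_funM; first exact: prim_measurable.
  exact: integrable_measurable gi.
- by apply: integrableZl_real => //; exact: integrable_norm gi.
move=> t /=; rewrite in_itv /= => /andP[_ tT].
by rewrite normrM ler_wpM2r// prim_le.
Qed.

End Primitive.

(** * Integration by parts for absolutely continuous functions *)

Section ProductRule.
Variable R : realType.
Notation mu := (@lebesgue_measure R).
Variables (T : R).
Hypothesis T0 : 0 <= T.
Implicit Types (f g : R -> R).

Lemma integrable_restrictT f : mu.-integrable `[0, T] (EFin \o f) ->
  mu.-integrable setT (EFin \o (f \_ `[0, T])).
Proof.
by move=> fi; rewrite -restrict_EFin; apply: (integrable_mkcond _ _).1 fi.
Qed.

Lemma integrable_prod (u v : measurableTypeR R -> R) :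
  mu.-integrable setT (EFin \o u) -> mu.-integrable setT (EFin \o v) ->
  (mu \x mu)%E.-integrable setT (EFin \o (fun z => u z.1 * v z.2)).
Proof.
move=> ui vi.
have um : measurable_fun setT u by exact: integrable_measurable ui.
have mv : measurable_fun setT v by exact: integrable_measurable vi.
apply/integrable12ltyP.
  apply/measurable_EFinP/measurable_funM.
    by apply: measurableT_comp => //; exact: measurable_fst.
  by apply: measurableT_comp => //; exact: measurable_snd.
have inner x : (\int[mu]_y `|(u x * v y)%:E| = `|u x|%:E * \int[mu]_y `|v y|%:E)%E.
  rewrite -ge0_integralZl//=.
  - by apply: eq_integral => y _; rewrite normrM.
  - by apply/measurable_EFinP; exact: measurableT_comp.
under eq_integral => x _ do rewrite /= inner.
have /integrableP[_ vfin] := vi; have /integrableP[_ ufin] := ui.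
have vE : (\int[mu]_y `|v y|%:E)%E \is a fin_num.
  by rewrite ge0_fin_numE//; exact: integral_ge0.
rewrite -(fineK vE); under eq_integral do rewrite muleC.
rewrite ge0_integralZl_EFin//.
- by apply: lte_mul_pinfty => //; rewrite lee_fin fine_ge0// integral_ge0.
- by apply/measurable_EFinP; exact: measurableT_comp.
- by rewrite fine_ge0// integral_ge0.
Qed.

Lemma prim_sub f s : mu.-integrable `[0, T] (EFin \o f) -> 0 <= s <= T ->
  \int[mu]_(t in `[s, T]) f t = prim f T - prim f s.
Proof.
move=> fi /andP[s0 sT]; rewrite /prim (Rintegral_itvB fi).
- rewrite Rintegral_itv_obnd_cbnd//; apply: integrableS fi => //.
  by apply: subset_itvr; rewrite bnd_simp.
- by rewrite bnd_simp.
- by rewrite bnd_simp.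
Qed.

(** Integrating f(s) g(t) over the triangle first in t leaves f(s) (prim g T - prim g s), and first
    in s leaves prim f t g(t). Equating the two integrals gives the product rule with no pointwise
    derivative. *)
Lemma primM f g : mu.-integrable `[0, T] (EFin \o f) ->
  mu.-integrable `[0, T] (EFin \o g) ->
  prim f T * prim g T = \int[mu]_(t in `[0, T]) (f t * prim g t + prim f t * g t).
Proof.
move=> fi gi.
(* Extension by zero lets Fubini run over the whole plane; the kernel [k] then carries the
   triangle. *)
pose u := f \_ `[0, T]; pose v := g \_ `[0, T].
have ui := integrable_restrictT fi; have vi := integrable_restrictT gi.
pose k (z : measurableTypeR R * measurableTypeR R) :=
  if z.1 <= z.2 then u z.1 * v z.2 else 0.
have mk : measurable_fun setT k.
  apply: measurable_fun_ifT => //.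
    by apply: measurable_fun_ler; [exact: measurable_fst|exact: measurable_snd].
  by have /measurable_int/measurable_EFinP := integrable_prod ui vi.
have ki : (mu \x mu)%E.-integrable setT (EFin \o k).
  apply: le_integrable (integrable_prod ui vi) => //.
    exact/measurable_EFinP.
  move=> z _ /=; rewrite /k; case: ifP => // _; by rewrite normr0 lee_fin.
have inner1 s : (\int[mu]_t (k (s, t))%:E = (u s * (prim g T - prim g s))%:E)%E.
  rewrite /k /=; have [sI|sI] := boolP (s \in `[0, T]); last first.
    rewrite /u patchE mem_setE (negbTE sI) mul0r.
    by under eq_integral do rewrite mul0r if_same; rewrite integral0.
  have sT : `[s, T] `<=` `[0, T].
    by apply: subset_itvr; rewrite bnd_simp (itvP sI).
  have gsi : mu.-integrable `[s, T] (EFin \o g) by apply: integrableS gi.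
  have s0T : 0 <= s <= T by move: sI; rewrite in_itv.
  have gssi : mu.-integrable `[s, T] (EFin \o (fun t => f s * g t)).
    exact: integrableZl_real.
  rewrite -(prim_sub gi s0T) /u patchE mem_setE sI -RintegralZl//.
  rewrite /Rintegral fineK; last exact: integrable_fin_num gssi.
  rewrite [RHS]integral_mkcond; apply: eq_integral => t _.
  rewrite /u /v !patchE !mem_setE !in_itv /=.
  have [st|st] := leP s t; last by [].
  have /andP[s0 _] := s0T; rewrite (le_trans s0 st) /=.
  by case: ifP; rewrite ?mulr0.
have inner2 t : (\int[mu]_s (k (s, t))%:E = (prim f t * v t)%:E)%E.
  rewrite /k /=; have [tI|tI] := boolP (t \in `[0, T]); last first.
    rewrite /v patchE mem_setE (negbTE tI) mulr0.
    by under eq_integral do rewrite mulr0 if_same; rewrite integral0.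
  have tT : t <= T by rewrite (itvP tI).
  have fti := integrable_le fi tT.
  have fgti : mu.-integrable `[0, t] (EFin \o (fun s => f s * g t)).
    by apply: (eq_integrable_real _ _ (integrableZl_real (g t) _ fti)) => // s _;
      rewrite mulrC.
  rewrite /v patchE mem_setE tI /prim -RintegralZr//.
  rewrite /Rintegral fineK; last exact: integrable_fin_num fgti.
  rewrite [RHS]integral_mkcond; apply: eq_integral => s _.
  rewrite /u /v !patchE !mem_setE !in_itv /=.
  have [st|st] := leP s t; last by rewrite andbF.
  rewrite (le_trans st tT) !andbT.
  by case: ifP; rewrite ?mul0r.
have := Fubini ki; under eq_integral do rewrite /= inner1.
under [X in _ = X]eq_integral do rewrite /= inner2.
move/(congr1 fine); rewrite -!/(Rintegral _ _ _).
have fgi : mu.-integrable `[0, T] (EFin \o (fun t => prim g t * f t)).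
  exact: integrable_primM.
have gfi : mu.-integrable `[0, T] (EFin \o (fun t => prim f t * g t)).
  exact: integrable_primM.
have -> : \int[mu]_s (u s * (prim g T - prim g s)) =
    \int[mu]_(s in `[0, T]) (f s * prim g T - prim g s * f s).
  rewrite [RHS]Rintegral_mkcond; apply: eq_Rintegral => s _.
  by rewrite /u !patchE; case: ifP => _; rewrite ?mul0r//; ring.
have -> : \int[mu]_t (prim f t * v t) = \int[mu]_(t in `[0, T]) (prim f t * g t).
  rewrite [RHS]Rintegral_mkcond; apply: eq_Rintegral => t _.
  by rewrite /v !patchE; case: ifP => _; rewrite ?mulr0.
have fgT : mu.-integrable `[0, T] (EFin \o (fun t => f t * prim g T)).
  by apply: (eq_integrable_real _ _ (integrableZl_real (prim g T) _ fi)) => // t _;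
    rewrite mulrC.
rewrite RintegralB// RintegralZr// -/(prim f T) => E.
rewrite RintegralD//; last first.
  by apply: eq_integrable_real fgi => // t _; rewrite mulrC.
rewrite -E; under eq_Rintegral do rewrite mulrC; ring.
Qed.

End ProductRule.

(** * Caratheodory differential equations *)

Section OdeSolutions.
Variable R : realType.
Notation mu := (@lebesgue_measure R).

Lemma ode_integrable k (x f : R -> 'cV[R]_k) T i : ode_solution x f -> 0 <= T ->
  mu.-integrable `[0, T] (EFin \o (fun t => f t i 0)).
Proof. by move=> xf T0; case: (xf T i T0). Qed.

Lemma ode_primE k (x f : R -> 'cV[R]_k) T i : ode_solution x f -> 0 <= T ->
  x T i 0 = prim (fun t => f t i 0) T.
Proof. by move=> xf T0; case: (xf T i T0). Qed.

Lemma prim_sqint (T : R) (f : R -> R) : 0 <= T ->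
  mu.-integrable `[0, T] (EFin \o f) -> sqint `[0, T] (prim f).
Proof.
move=> T0 fi.
apply: (@bounded_sqint _ _ _ (\int[mu]_(s in `[0, T]) `|f s|)) => //.
- exact: lebesgue_itv_finite.
- exact: prim_measurable.
- by move=> t /=; rewrite in_itv /= => /andP[_ tT]; exact: prim_le.
Qed.

Lemma ode_sqint k (x f : R -> 'cV[R]_k) T i : ode_solution x f -> 0 <= T ->
  sqint `[0, T] (fun t => x t i 0).
Proof.
move=> xf T0; apply: eq_sqint (prim_sqint T0 (ode_integrable i xf T0)) => //.
move=> t; rewrite inE /= in_itv /= => /andP[t0 _].
by rewrite (ode_primE i xf t0).
Qed.

(** The product rule is applied to each pair of coordinates, and symmetry of P turns the two halves
    into twice one of them. There is no initial term, since [ode_solution] includes x(0) = 0. *)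
Lemma ode_quadform k (x f : R -> 'cV[R]_k) (P : 'M[R]_k) T :
  ode_solution x f -> 0 <= T -> P^T = P ->
  mu.-integrable `[0, T] (EFin \o (fun t => 2 * bilin P (x t) (f t))) /\
  quadform P (x T) = \int[mu]_(t in `[0, T]) (2 * bilin P (x t) (f t)).
Proof.
move=> xf T0 sP.
have fi i := ode_integrable i xf T0.
have xE t i : 0 <= t <= T -> x t i 0 = prim (fun t => f t i 0) t.
  by move=> /andP[t0 _]; exact: ode_primE.
pose F i j t := f t i 0 * prim (fun t => f t j 0) t
              + prim (fun t => f t i 0) t * f t j 0.
have Fi i j : mu.-integrable `[0, T] (EFin \o F i j).
  apply: integrableD_real => //; last exact: integrable_primM.
  by apply: eq_integrable_real (integrable_primM T0 (fi j) (fi i)) => // t _;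
    rewrite mulrC.
have FE t : 0 <= t <= T ->
    \sum_i \sum_j P i j * F i j t = 2 * bilin P (x t) (f t).
  move=> tI; transitivity (bilin P (f t) (x t) + bilin P (x t) (f t)).
    rewrite !bilin_sum -big_split; apply: eq_bigr => i _ /=.
    rewrite -big_split; apply: eq_bigr => j _ /=.
    by rewrite -mulrDr /F -!xE.
  by rewrite -[bilin P (f t) _]bilin_tr sP; ring.
have Fsum : mu.-integrable `[0, T]
    (EFin \o (fun t => \sum_i \sum_j P i j * F i j t)).
  by do 2 (apply: integrable_sum_real => // ?); exact: integrableZl_real.
split.
  by apply: eq_integrable_real Fsum => // t; rewrite inE /= in_itv => /FE.
transitivity (\int[mu]_(t in `[0, T]) (\sum_i \sum_j P i j * F i j t)); last first.
  by apply: eq_Rintegral => t; rewrite inE /= in_itv => /FE.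
rewrite quadformE bilin_sum Rintegral_sum//; last first.
  by move=> i; apply: integrable_sum_real => // j; exact: integrableZl_real.
apply: eq_bigr => i _; rewrite Rintegral_sum//; last first.
  by move=> j; exact: integrableZl_real.
apply: eq_bigr => j _; rewrite RintegralZl//; congr (_ * _).
by rewrite !(ode_primE _ xf T0) primM.
Qed.

Lemma expR_integral (c t : R) : 0 < c -> 0 <= t ->
  mu.-integrable `[0, t] (EFin \o (fun s => expR (c * s))) /\
  \int[mu]_(s in `[0, t]) (c * expR (c * s)) = expR (c * t) - 1.
Proof.
move=> c0 t0.
have cc : continuous (fun s : R => expR (c * s)).
  move=> s; apply: continuous_comp; last exact: continuous_expR.
  by apply: cvgM; [exact: cvg_cst|exact: cvg_id].
split.
  apply: continuous_compact_integrable; first exact: segment_compact.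
  exact: continuous_subspaceT.
move: t0; rewrite le_eqVlt => /predU1P[<-|t0].
  by rewrite set_itv1 Rintegral_set1 mulr0 expR0 subrr.
have dF (s : R) :
    is_derive s (1 : R) (fun s : R => expR (c * s)) (c * expR (c * s)).
  have dc : is_derive s (1 : R) (fun s : R => c * s) c.
    have := is_deriveZ c (is_derive_id s (1 : R)); rewrite /= => dc.
    by apply: is_derive_eq dc _; rewrite /GRing.scale /= mulr1.
  by rewrite mulrC; exact: (is_derive1_comp (is_derive_expR (c * s)) dc).
rewrite /Rintegral (@continuous_FTC2 _ _ (fun s => expR (c * s)))//=.
- by rewrite mulr0 expR0.
- apply: continuous_subspaceT => s; apply: cvgM; [exact: cvg_cst|exact: cc].
- split.
  + by move=> s _; case: (dF s).
  + by apply: cvg_at_right_filter; exact: cc.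
  + by apply: cvg_at_left_filter; exact: cc.
- by move=> s _; rewrite derive1E; case: (dF s).
Qed.

End OdeSolutions.

Lemma cvg_mulmx (R : realType) (I : Type) (F : set_system I) {FF : Filter F}
    a b (A : 'M[R]_(a, b)) (u : I -> 'cV[R]_b) (v : 'cV[R]_b) :
  (forall j, u x j 0 @[x --> F] --> v j 0) ->
  forall i, (A *m u x) i 0 @[x --> F] --> (A *m v) i 0.
Proof.
move=> uv i; rewrite mxE; under eq_fun do rewrite mxE.
have H (s : seq 'I_b) : \sum_(j <- s) A i j * u x j 0 @[x --> F] -->
    \sum_(j <- s) A i j * v j 0.
  elim: s => [|j s IH].
    by rewrite big_nil; under eq_fun do rewrite big_nil; exact: cvg_cst.
  rewrite big_cons; under eq_fun do rewrite big_cons.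
  by apply: cvgD => //; apply: cvgM; [exact: cvg_cst|exact: uv].
exact: H.
Qed.

(** * Picard iteration for linear systems with integrable forcing *)

Section LinearODE.
Variables (R : realType) (k : nat) (A : 'M[R]_k) (f : R -> 'cV[R]_k).
Notation mu := (@lebesgue_measure R).
Hypothesis fi : forall (T : R) i, 0 <= T ->
  mu.-integrable `[0, T] (EFin \o (fun t => f t i 0)).

Fixpoint picard (n : nat) (t : R) : 'cV[R]_k :=
  if n is n'.+1
  then \col_i \int[mu]_(s in `[0, t]) (A *m picard n' s + f s) i 0
  else 0.

Definition picard_rhs n t : 'cV[R]_k := A *m picard n t + f t.

Lemma picardS n t i : picard n.+1 t i 0 = prim (fun s => picard_rhs n s i 0) t.
Proof. by rewrite /= mxE. Qed.

Lemma picard_integrable n (T : R) i : 0 <= T ->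
  mu.-integrable `[0, T] (EFin \o (fun t => picard n t i 0)) /\
  mu.-integrable `[0, T] (EFin \o (fun t => picard_rhs n t i 0)).
Proof.
move=> T0.
have step m :
    (forall i, mu.-integrable `[0, T] (EFin \o (fun t => picard m t i 0))) ->
    forall i, mu.-integrable `[0, T] (EFin \o (fun t => picard_rhs m t i 0)).
  move=> pm j; apply: (@eq_integrable_real _ _
    (fun t => (A *m picard m t) j 0 + f t j 0)) => //.
    by move=> t _; rewrite /picard_rhs [RHS]mxE.
  by apply: integrableD_real => //; [exact: integrable_mulmx|exact: fi].
suff pn : forall i, mu.-integrable `[0, T] (EFin \o (fun t => picard n t i 0)).
  by split; [exact: pn|exact: step].
elim: n => [|n IH] {}i.
  by apply: (eq_integrable_real _ _ (integrable0 _ _)) => // t _; rewrite mxE.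
apply: (@eq_integrable_real _ _ (prim (fun s => picard_rhs n s i 0))) => //.
  by move=> t _; rewrite picardS.
apply: sqint_integrable => //; first exact: lebesgue_itv_finite.
by apply: prim_sqint => //; exact: step.
Qed.

(** An upper bound for the operator norm of A in the sup norm; the 1 keeps it positive when A =
    0. *)
Let a : R := 1 + \sum_i \sum_j `|A i j|.

Let a_gt0 : 0 < a.
Proof. by rewrite ltr_pwDl// sumr_ge0// => i _; exact: sumr_ge0. Qed.

Lemma mulmx_bound (u : 'cV[R]_k) (c : R) i : 0 <= c ->
  (forall j, `|u j 0| <= c) -> `|(A *m u) i 0| <= a * c.
Proof.
move=> c0 uc; rewrite mxE (le_trans (ler_norm_sum _ _ _))//.
apply: (@le_trans _ _ (\sum_j `|A i j| * c)).
  by apply: ler_sum => j _; rewrite normrM ler_wpM2l.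
rewrite -mulr_suml ler_wpM2r// /a [X in 1 + X](bigD1 i)//= addrCA lerDl addr_ge0//.
by apply: sumr_ge0 => *; exact: sumr_ge0.
Qed.

Definition forcing (T : R) := \sum_i \int[mu]_(s in `[0, T]) `|f s i 0|.

Lemma forcing_ge0 T : 0 <= forcing T.
Proof. by apply: sumr_ge0 => i _; exact: Rintegral_ge0. Qed.

(* The weight expR (2 a t) turns each Picard step into a contraction by 1/2. *)
Lemma picard_step n (T t : R) i : 0 <= t <= T ->
  `|(picard n.+1 t - picard n t) i 0| <= forcing T * 2^-n * expR (2 * a * t).
Proof.
move=> /andP[t0 tT]; have T0 := le_trans t0 tT.
have pi m j := (picard_integrable m j T0).1.
have ri m j := (picard_integrable m j T0).2.
elim: n i t t0 tT => [|n IH] i t t0 tT.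
  rewrite !mxE subr0 expr0 invr1 mulr1.
  under eq_Rintegral => s _ do rewrite mulmx0 add0r.
  have fT0 := forcing_ge0 T.
  apply: (@le_trans _ _ (forcing T)); last first.
    by rewrite ler_peMr// -expR0 ler_expR !mulr_ge0// ltW.
  apply: le_trans (prim_le (fi i T0) tT) _.
  rewrite /forcing (bigD1 i)//= lerDl.
  by apply: sumr_ge0 => j _; exact: Rintegral_ge0.
rewrite [_ i 0]mxE [X in _ + X]mxE !picardS /prim -RintegralB//; first last.
- exact: integrable_le (ri _ _) tT.
- exact: integrable_le (ri _ _) tT.
set c := forcing T * 2^-n.
have c0 : 0 <= c by rewrite mulr_ge0 ?forcing_ge0// invr_ge0 exprn_ge0.
have [ei eI] := expR_integral (mulr_gt0 (@ltr0n R 2) a_gt0) t0.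
have di : mu.-integrable `[0, t]
    (EFin \o (fun s => picard_rhs n.+1 s i 0 - picard_rhs n s i 0)).
  apply: (@eq_integrable_real _ _
    (fun s => picard_rhs n.+1 s i 0 + (-1) * picard_rhs n s i 0)) => //.
    by move=> s _; rewrite mulN1r.
  apply: integrableD_real => //; first exact: integrable_le (ri _ _) tT.
  by apply: integrableZl_real => //; exact: integrable_le (ri _ _) tT.
apply: le_trans (le_normr_Rintegral _ di) _ => //.
(* The integrand a c expR (2 a s) is written with the factor 2 a split off, whose integral is expR
   (2 a t) - 1; what remains outside is c / 2, the gain of one iteration. *)
apply: (@le_trans _ _
    (\int[mu]_(s in `[0, t]) (c / 2 * (2 * a * expR (2 * a * s))))).
  apply: le_Rintegral => //; first exact: integrable_norm di.
    by do 2 (apply: integrableZl_real => //).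
  move=> s /=; rewrite in_itv /= => /andP[s0 st].
  have -> : picard_rhs n.+1 s i 0 - picard_rhs n s i 0 =
      (A *m (picard n.+1 s - picard n s)) i 0.
    by rewrite mulmxBr /picard_rhs ![in LHS]mxE ![in RHS]mxE; ring.
  have -> : c / 2 * (2 * a * expR (2 * a * s)) = a * (c * expR (2 * a * s)).
    by field.
  apply: mulmx_bound => [|j]; first by rewrite mulr_ge0// expR_ge0.
  by apply: IH => //; exact: le_trans tT.
rewrite RintegralZl//; last exact: integrableZl_real.
rewrite eI /c exprS invfM.
have : 0 <= forcing T * 2^-n by [].
have : 0 <= 1 / 2 * (forcing T * 2^-n) by rewrite mulr_ge0.
set e := expR _; nra.
Qed.

Lemma picard_bound (T t : R) i n : 0 <= t <= T ->
  `|(picard n.+1 t - picard n t) i 0| <= forcing T * expR (2 * a * T) * 2^-n.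
Proof.
move=> tT; apply: le_trans (picard_step n i tT) _.
have /andP[t0 tT'] := tT.
rewrite [leRHS]mulrAC ler_wpM2l//.
  by rewrite mulr_ge0 ?forcing_ge0// invr_ge0 exprn_ge0.
by rewrite ler_expR ler_wpM2l// mulr_ge0// ltW.
Qed.

Lemma picard_le (T t : R) i n : 0 <= t <= T ->
  `|picard n t i 0| <= forcing T * expR (2 * a * T) * 2.
Proof.
move=> tT; set c := forcing T * _.
have c0 : 0 <= c by rewrite mulr_ge0 ?forcing_ge0// expR_ge0.
(* The factor 2 - 2 * 2^-n is the sum of the first n powers of 1/2, the form that telescopes through
   the induction. *)
suff H : `|picard n t i 0| <= c * (2 - 2 * 2^-n).
  apply: le_trans H _; rewrite ler_wpM2l// gerBl mulr_ge0// invr_ge0.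
elim: n => [|n IH]; first by rewrite mxE normr0 expr0 invr1 mulr1 subrr mulr0.
have := picard_bound i n tT; rewrite [_ i 0]mxE [X in _ + X]mxE -/c => D.
have := ler_normD (picard n t i 0) (picard n.+1 t i 0 - picard n t i 0).
rewrite subrKC; move/le_trans; apply.
apply: le_trans (lerD IH D) _; rewrite exprS invfM.
by rewrite le_eqVlt; apply/orP; left; apply/eqP; field; rewrite expf_neq0.
Qed.

(** The iterates are the partial sums of their increments, which a geometric series dominates. *)
Lemma picard_cvg (t : R) i : 0 <= t -> cvgn (fun n => picard n t i 0).
Proof.
move=> t0; have tt : 0 <= t <= t by rewrite t0 lexx.
set u := fun n => picard n t i 0.
have -> : u = (fun n => u 0%N + series (telescope u) n).
  by apply/funext => n; exact: eq_sum_telescope.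
apply: is_cvgD; first exact: is_cvg_cst.
set c := forcing t * expR (2 * a * t).
have c0 : 0 <= c by rewrite mulr_ge0 ?forcing_ge0// expR_ge0.
apply: normed_cvg; apply: (@series_le_cvg _ _ (geometric c 2^-1)) => [n|n|n|].
- exact: normr_ge0.
- by rewrite /= mulr_ge0// exprn_ge0.
- rewrite /= exprVn; apply: le_trans (picard_bound i n tt).
  by rewrite [X in _ <= `|X|]mxE [X in _ <= `|_ + X|]mxE.
- apply: is_cvg_geometric_series; rewrite gtr0_norm//; lra.
Qed.

(** The right-hand sides converge pointwise and are dominated by a constant plus |f|, so dominated
    convergence carries the recursion to the limit on every [0,T]. *)
Lemma linear_ode : exists x, ode_solution x (fun t => A *m x t + f t).
Proof.
pose x t : 'cV[R]_k := \col_i limn (fun n => picard n t i 0).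
have px t i : 0 <= t -> picard n t i 0 @[n --> \oo] --> x t i 0.
  by move=> t0; rewrite mxE; exact: picard_cvg.
exists x => T i T0.
have pi m j := (picard_integrable m j T0).1.
have ri m j := (picard_integrable m j T0).2.
pose b := a * (forcing T * expR (2 * a * T) * 2).
have ib : mu.-integrable `[0, T] (EFin \o (fun t => b + `|f t i 0|)).
  apply: integrableD_real => //; last exact: integrable_norm (fi i T0).
  apply: (@bounded_integrable _ _ _ `|b|) => //; exact: lebesgue_itv_finite.
have rx t : 0 <= t ->
    picard_rhs n t i 0 @[n --> \oo] --> (A *m x t + f t) i 0.
  move=> t0; rewrite [X in _ --> X]mxE.
  under eq_fun do rewrite mxE.
  apply: cvgD; last exact: cvg_cst.
  by apply: cvg_mulmx => j; exact: px.
have rx' : {ae mu, forall t, `[0, T]%classic t ->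
    (EFin \o (fun t => picard_rhs n t i 0)) t @[n --> \oo]
      --> (EFin \o (fun t => (A *m x t + f t) i 0)) t}.
  apply: aeW => t /=; rewrite in_itv /= => /andP[t0 _].
  by apply: cvg_EFin; [exact: nearW|exact: rx].
have mrhs n : measurable_fun `[0, T] (EFin \o (fun t => picard_rhs n t i 0)).
  exact: measurable_int (ri n i).
have mlim : measurable_fun `[0, T] (EFin \o (fun t => (A *m x t + f t) i 0)).
  apply/measurable_EFinP.
  apply: (@measurable_fun_cvg _ _ _ _ (fun n t => picard_rhs n t i 0)).
    by move=> n; exact: integrable_measurable (ri n i).
  by move=> t /=; rewrite in_itv /= => /andP[t0 _]; exact: rx.
have dom : {ae mu, forall t n, `[0, T]%classic t ->
    (`|(EFin \o (fun t => picard_rhs n t i 0)%R) t| <=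
      (EFin \o (fun t => b + `|f t i 0|)%R) t)%E}.
  apply: aeW => t n /=; rewrite in_itv /= => tT.
  rewrite lee_fin /picard_rhs mxE (le_trans (ler_normD _ _))// lerD2r.
  apply: mulmx_bound => [|j]; last exact: picard_le.
  by rewrite !mulr_ge0 ?forcing_ge0// expR_ge0.
have [||lim_int _ lim_cvg] :=
  @dominated_convergence _ _ _ mu `[0, T]%classic _ _ _ _ mrhs mlim _ ib dom.
- by [].
- exact: rx'.
split=> //.
have picS : picard n.+1 T i 0 @[n --> \oo] -->
    \int[mu]_(t in `[0, T]) (A *m x t + f t) i 0.
  under eq_fun do rewrite picardS.
  apply: fine_cvg; rewrite fineK//; exact: integrable_fin_num lim_int.
have := px T i T0; rewrite -cvg_shiftS /= => picx.
exact: cvg_unique picx picS.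
Qed.

End LinearODE.

(** * Traces of H^m functions *)

Section Sobolev.
Variables (R : realType) (m l : nat).
Notation mu := (@lebesgue_measure R).
Implicit Types (u v w : jet R l).

(** Descending induction from the top derivative, the only one assumed square integrable: each lower
    one is a constant plus a primitive, hence bounded on [0,1]. *)
Lemma Hm_sqint u k i : Hm m u -> (k <= m)%N ->
  sqint `[0, 1] (fun x => u k x i 0).
Proof.
move=> [um ufin uE] km.
have [j ->] : exists j, k = (m - j)%N by exists (m - k)%N; rewrite subKn.
elim: j i => [|j IH] i; first by rewrite subn0; exact: integrable_sqnorm_coord.
(* Subtraction is truncated: once j reaches m the index stays at 0 and nothing is left to prove. *)
have [mj|jm] := leqP m j.
  have -> : (m - j.+1 = m - j)%N by move: mj; rewrite -subn_eq0 subnS => /eqP ->.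
  exact: IH.
have kE : (m - j = (m - j.+1).+1)%N by rewrite subnSK.
apply: (@eq_sqint _ _ (fun x => u (m - j.+1)%N 0 i 0
    + prim (fun s => u (m - j)%N s i 0) x)) => //.
  move=> x; rewrite inE /= in_itv /= => x01; rewrite [RHS]uE//.
    by rewrite /prim kE.
  by rewrite -kE leq_subr.
apply: sqintD => //.
  apply: (@bounded_sqint _ _ _ `|u (m - j.+1)%N 0 i 0|) => //.
  exact: lebesgue_itv_finite.
apply: prim_sqint => //; apply: sqint_integrable => //.
exact: lebesgue_itv_finite.
Qed.

Lemma Hm_integrable u k i x : Hm m u -> (k <= m)%N -> x <= 1 ->
  mu.-integrable `[0, x] (EFin \o (fun s => u k s i 0)).
Proof.
move=> uH km x1; apply: integrable_le x1; apply: sqint_integrable => //.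
  exact: lebesgue_itv_finite.
exact: Hm_sqint.
Qed.

Lemma Hm_lin (a : R) u v : Hm m u -> Hm m v ->
  Hm m (fun k x => a *: u k x + v k x).
Proof.
move=> uH vH; have [um _ uE] := uH; have [vm _ vE] := vH.
have sq i : sqint `[0, 1] (fun x => (a *: u m x + v m x) i 0).
  apply: (@eq_sqint _ _ (fun x => a * u m x i 0 + v m x i 0)) => //.
    by move=> x _; rewrite !mxE.
  by apply: sqintD => //; [apply: sqintZ => //|]; exact: Hm_sqint.
split.
- by move=> i; case: (sq i).
- have /integrableP[_] := sqint_sqnorm (measurable_itv _) sq.
  congr (_ < _)%E; apply: eq_integral => x _ /=.
  by rewrite ger0_norm// sqnorm_ge0.
- move=> k x i km /andP[x0 x1]; rewrite !mxE uE ?x0// vE ?x0//.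
  have ui : mu.-integrable `[0, x] (EFin \o (fun s => u k.+1 s i 0)).
    exact: Hm_integrable.
  have vi : mu.-integrable `[0, x] (EFin \o (fun s => v k.+1 s i 0)).
    exact: Hm_integrable.
  have -> : \int[mu]_(s in `[0, x]) (a *: u k.+1 s + v k.+1 s) i 0 =
      \int[mu]_(s in `[0, x]) (a * u k.+1 s i 0 + v k.+1 s i 0).
    by apply: eq_Rintegral => s _; rewrite !mxE.
  by rewrite RintegralD ?RintegralZl//; [ring|exact: integrableZl_real].
Qed.

Lemma Hm_sqnorm_ge u k i : Hm m u -> (k <= m)%N ->
  ((\int[mu]_(x in `[0, 1]) (u k x i 0) ^+ 2)%:E <= Hm_sqnorm m u)%E.
Proof.
move=> uH km; have [_ ui2] := Hm_sqint i uH km.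
rewrite /Rintegral fineK; last exact: integrable_fin_num ui2.
have kS : (k < m.+1)%N by rewrite ltnS.
rewrite /Hm_sqnorm (bigD1 (Ordinal kS))//=.
apply: (@le_trans _ _ (\int[mu]_(x in `[0%R, 1%R]) (sqnorm (u k x))%:E)%E).
  apply: ge0_le_integral => //.
  - by move=> x _; rewrite lee_fin sqr_ge0.
  - exact: measurable_int ui2.
  - apply/measurable_EFinP; apply: measurable_sum => j.
    by apply: measurable_funX; case: (Hm_sqint j uH km).
  - move=> x _; rewrite lee_fin /sqnorm (bigD1 i)//= lerDl.
    by apply: sumr_ge0 => j _; exact: sqr_ge0.
rewrite leeDl//; apply: sume_ge0 => j _; apply: integral_ge0 => x _.
by rewrite lee_fin sqnorm_ge0.
Qed.

Lemma Rintegral01_cst (c : R) : \int[mu]_(x in `[0, 1]) c = c.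
Proof.
have m01 : mu `[0%R, 1%R] = 1%E.
  by rewrite lebesgue_measure_itv /= lte_fin ltr01 sube0.
by rewrite Rintegral_cst//; move/(congr1 fine): m01 => /= ->; rewrite mulr1.
Qed.

(** From |s| <= (1 + s^2) / 2, integrated over an interval of length 1. *)
Lemma Hm_L1_le1 u k i : Hm m u -> (k <= m)%N -> (Hm_sqnorm m u < 1)%E ->
  \int[mu]_(x in `[0, 1]) `|u k x i 0| <= 1.
Proof.
move=> uH km u1; have [uk ui2] := Hm_sqint i uH km.
have i1 : mu.-integrable `[0, 1] (EFin \o (fun _ : R => (2^-1 : R))).
  apply: (@bounded_integrable _ _ _ `|2^-1|) => //; exact: lebesgue_itv_finite.
apply: (@le_trans _ _
  (\int[mu]_(x in `[0, 1]) (2^-1 + 2^-1 * (u k x i 0) ^+ 2))).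
  apply: le_Rintegral => //.
  - exact: integrable_norm (Hm_integrable i uH km (lexx 1)).
  - by apply: integrableD_real => //; exact: integrableZl_real.
  move=> x _; have := sqr_ge0 (`|u k x i 0| - 1).
  rewrite -(real_normK (num_real (u k x i 0))); nra.
rewrite RintegralD//; last exact: integrableZl_real.
rewrite RintegralZl// Rintegral01_cst.
have := Hm_sqnorm_ge i uH km; move=> /le_lt_trans/(_ u1).
rewrite lte_fin => h; lra.
Qed.

(** Averaging u(0) = u(x) - (integral of u' over [0,x]) over x bounds |u(0)| by two L^1 norms, each
    at most 1; reaching the endpoint 1 costs a third. A bound on the unit ball is enough for the
    difference quotients below. *)
Lemma Hm_trace_le u k i (e : R) : Hm m u -> (k < m)%N -> (Hm_sqnorm m u < 1)%E ->
  e = 0 \/ e = 1 -> `|u k e i 0| <= 3.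
Proof.
move=> uH km u1 e01; have [_ _ uE] := uH.
set b := \int[mu]_(x in `[0, 1]) `|u k.+1 x i 0|.
have b1 : b <= 1 by exact: Hm_L1_le1.
have ik := Hm_integrable i uH (ltnW km) (lexx 1).
have ik1 := Hm_integrable i uH km (lexx 1).
have pb x : x <= 1 -> `|\int[mu]_(s in `[0, x]) u k.+1 s i 0| <= b.
  by move=> x1; exact: (prim_le ik1 x1).
have ib : mu.-integrable `[0, 1] (EFin \o (fun _ : R => b)).
  apply: (@bounded_integrable _ _ _ `|b|) => //; exact: lebesgue_itv_finite.
have u0 : `|u k 0 i 0| <= 2.
  have -> : `|u k 0 i 0| = \int[mu]_(x in `[0, 1]) `|u k 0 i 0|.
    by rewrite Rintegral01_cst.
  apply: (@le_trans _ _ (\int[mu]_(x in `[0, 1]) (`|u k x i 0| + b))).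
    apply: le_Rintegral => //.
    - apply: (@bounded_integrable _ _ _ `|u k 0 i 0|) => //.
        exact: lebesgue_itv_finite.
      by move=> x _; rewrite normr_id.
    - by apply: integrableD_real => //; exact: integrable_norm ik.
    move=> x /=; rewrite in_itv /= => x01.
    have := uE k x i km x01; set J := Rintegral _ _ _ => xE.
    have -> : u k 0 i 0 = u k x i 0 - J by rewrite xE; lra.
    rewrite (le_trans (ler_normB _ _))// lerD2l; apply: pb.
    by case/andP: x01.
  rewrite RintegralD//; last exact: integrable_norm ik.
  rewrite Rintegral01_cst.
  have := Hm_L1_le1 i uH (ltnW km) u1; lra.
case: e01 => ->; first by lra.
rewrite uE//; last by rewrite ler01 lexx.
have := pb 1 (lexx 1).
have := ler_normD (u k 0 i 0) (\int[mu]_(s in `[0, 1]) u k.+1 s i 0).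
lra.
Qed.

(** For small h, the difference quotient minus [zt t] lies in the unit ball of H^m, so its trace is
    at most 3. The trace of z is therefore Lipschitz at t, with constant 3 plus the size of the
    trace of [zt t]. *)
Lemma C1_trace_continuous (z zt : R -> jet R l) k i (e : R) :
  C1_Hm m z zt -> (k < m)%N -> e = 0 \/ e = 1 ->
  {within `[0, +oo[, continuous (fun t => z t k e i 0)}.
Proof.
move=> zC km e01; apply/subspace_continuousP => t; rewrite /= in_itv /= andbT => t0.
have [zH ztH dz _] := zC t t0.
pose c := 3 + `|zt t k e i 0|.
have c0 : 0 < c by rewrite ltr_pwDl.
have near1 : nbhs (0%E : \bar R) [set y | (y < 1)%E].
  by apply: open_nbhs_nbhs; split; [exact: open_ereal_lt_ereal|exact: lte01].
have : nbhs (0 : R) [set h | h != 0 -> 0 <= t + h ->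
    (Hm_sqnorm m (fun k x => (h^-1 *: (z (t + h) k x - z t k x) - zt t k x)%R)
      < 1)%E] by exact: (dz _ near1).
move=> /nbhs_ballP[d /= d0 dH].
have lip h : `|h| < d -> 0 <= t + h ->
    `|z (t + h) k e i 0 - z t k e i 0| <= `|h| * c.
  move=> hd th; have [->|h0] := eqVneq h 0.
    by rewrite addr0 subrr normr0 mul0r.
  have := dH h; rewrite /ball /= sub0r normrN => /(_ hd h0 th) w1.
  set w := (fun k x => _) in w1.
  have wH : Hm m w.
    have [zhH _ _ _] := zC (t + h) th.
    (* The zero jet, needed to obtain a pure multiple from combinations of the form a u + v. *)
    have zero := Hm_lin (-1) zH zH.
    have := Hm_lin (-1) ztH (Hm_lin h^-1 (Hm_lin (-1) zH zhH) zero).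
    congr (Hm m _); apply/funext => j; apply/funext => x; rewrite /w.
    by rewrite !scaleN1r addNr addr0 addrC [- z t j x + _]addrC.
  have := Hm_trace_le i wH km w1 e01; rewrite /w !mxE => w3.
  set D := z (t + h) k e i 0 - z t k e i 0 in w3 *.
  rewrite -[D](mulVKf h0) normrM ler_wpM2l//.
  rewrite /c -lerBlDr; apply: le_trans w3; exact: lerB_dist.
apply/cvgrPdist_lt => eps eps0; rewrite near_withinE.
near=> s => /=; rewrite in_itv /= andbT => s0.
have st : `|s - t| < Num.min d (eps / c).
  near: s; apply/nbhs_ballP; exists (Num.min d (eps / c)) => /=.
    by rewrite lt_min d0 divr_gt0.
  by move=> y; rewrite /ball /= distrC.
move: st; rewrite lt_min => /andP[sd se].
rewrite distrC; have := lip (s - t) sd; rewrite subrKC => /(_ s0).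
by move=> /le_lt_trans; apply; rewrite -ltr_pdivlMr.
Unshelve. all: by end_near. Qed.

(** The triple is chosen before u, so continuity in time of a boundary entry reduces to that of a
    single trace. *)
Lemma bvecE (j : 'I_(2 * m * l)) : exists k i (e : R),
  [/\ (k < m)%N, e = 0 \/ e = 1 & forall u, bvec m u j 0 = u k e i 0].
Proof.
set s := cast_ord (esym (bdim m l)) j.
pose i2 := tagnat.sig2 s; case: (split_ordP i2) => i i2E.
  exists (tagnat.sig1 s : nat), i, 0; split=> //; first by left.
  by move=> u; rewrite /bvec castmxE /= mxE -/s -/i2 i2E col_mxEu cast_ord_id.
exists (tagnat.sig1 s : nat), i, 1; split=> //; first by right.
by move=> u; rewrite /bvec castmxE /= mxE -/s -/i2 i2E col_mxEd cast_ord_id.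
Qed.

Lemma bvec_continuous (z zt : R -> jet R l) j : C1_Hm m z zt ->
  {within `[0, +oo[, continuous (fun t => bvec m (z t) j 0)}.
Proof.
move=> zC; have [k [i [e [km e01 bE]]]] := bvecE j.
rewrite (_ : (fun _ => _) = (fun t => z t k e i 0)).
  exact: C1_trace_continuous zC km e01.
by apply/funext => t; rewrite bE.
Qed.

End Sobolev.

Section HalfLine.
Variable R : realType.
Notation mu := (@lebesgue_measure R).

Lemma continuous_sqint (T : R) (f : R -> R) :
  {within `[0, +oo[, continuous f} -> sqint `[0, T] f.
Proof.
move=> cf; have cfT : {within `[0, T], continuous f}.
  by apply: continuous_subspaceW cf; apply: subset_itvl; rewrite bnd_simp.
split; first exact: subspace_continuous_measurable_fun.
apply: continuous_compact_integrable; first exact: segment_compact.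
move=> x; apply: cvgM; exact: cfT.
Qed.

Lemma continuous_L2e k (u : R -> 'cV[R]_k) :
  (forall i, {within `[0, +oo[, continuous (fun t => u t i 0)}) -> L2e u.
Proof.
move=> cu; apply: sqint_L2e => [i|T i T0]; last exact: continuous_sqint.
by apply: subspace_continuous_measurable_fun => //; exact: cu.
Qed.

End HalfLine.

(** * Consequences of well-posedness *)

Section WellPosedness.
Variable R : realType.
Notation mu := (@lebesgue_measure R).

Lemma ae_imply2 (P Q W : R -> Prop) : (forall t, P t -> Q t -> W t) ->
  {ae mu, forall t, P t} -> {ae mu, forall t, Q t} -> {ae mu, forall t, W t}.
Proof. exact: (@filterS2 _ _ (ae_filter_ringOfSetsType mu) P Q W). Qed.

Lemma ae_exists_itv (P : R -> Prop) (a b : R) : a < b ->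
  {ae mu, forall t, P t} -> exists2 t, a < t < b & P t.
Proof.
move=> ab [N [mN N0 PN]]; apply: contrapT => noP.
have abN : `]a, b[%classic `<=` N.
  move=> t /=; rewrite in_itv /= => tab; apply: PN => Pt.
  by apply: noP; exists t.
have : (mu `]a, b[%classic <= mu N)%E.
  by apply: le_measure => //; rewrite inE.
by rewrite N0 lebesgue_measure_itv /= lte_fin ab lee_fin leNgt subr_gt0 ab.
Qed.

Lemma ode_continuous k (x f : R -> 'cV[R]_k) i : ode_solution x f ->
  {within `[0, +oo[, continuous (fun t => x t i 0)}.
Proof.
move=> xf; apply/subspace_continuousP => t; rewrite /= in_itv /= andbT => t0.
(* A horizon beyond t makes the continuity at t two-sided rather than that at a right endpoint. *)
have t1 : 0 <= t + 1 by rewrite addr_ge0.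
have := prim_cont t1 (ode_integrable i xf t1).
move=> /subspace_continuousP/(_ t); rewrite /= in_itv /= t0 lerDl ler01.
move=> /(_ isT) ct; apply/cvgrPdist_lt => e e0.
move/cvgrPdist_lt : ct => /(_ e e0); rewrite !near_withinE => ct.
have near1 : \forall s \near t, s < t + 1.
  apply/nbhs_ballP; exists 1 => //= s; rewrite /ball /= => ts.
  by rewrite -ltrBlDl (le_lt_trans (ler_norm _))// distrC.
apply: filterS2 near1 ct => s s1 H; rewrite /= in_itv /= andbT => s0.
change (`|x t i 0 - x s i 0| < e); rewrite !(ode_primE _ xf)//; apply: H.
by rewrite /= in_itv /= s0 ltW.
Qed.

Variables (m l n r p : nat) (S : pde R m l p r) (G : lti R n r p).

(** A step along the j-th unit vector. The jump sits at time 1, inside the half line, so that both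
    sides of it can be observed. *)
Let switch (j : 'I_r) (t : R) : 'cV[R]_r :=
  if 1 <= t then delta_mx j 0 else 0.

Lemma switch_L2e j : L2e (switch j).
Proof.
have sm i : measurable_fun setT (fun t => switch j t i 0).
  have -> : (fun t => switch j t i 0) =
      (fun t : R => if 1 <= t then delta_mx j 0 i (0 : 'I_1) else 0 : R).
    by apply/funext => t; rewrite /switch; case: ifP => _; rewrite ?mxE.
  by apply: measurable_fun_ifT => //; exact: measurable_fun_ler.
apply: sqint_L2e => [i|T i T0]; first exact: measurable_funTS.
apply: (@bounded_sqint _ _ _ 1) => //.
- exact: lebesgue_itv_finite.
- exact: (measurable_funTS (sm i)).
move=> t _; rewrite /switch; case: ifP => _; rewrite mxE; last first.
  by rewrite normr0.
by case: (_ && _); rewrite ?normr0 ?normr1.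
Qed.

(* K D d agrees a.e. with a function of time that is continuous on [0, +oo[,
   which is impossible when d jumps along a vector outside ker (K D). *)
Lemma no_feedthrough : well_posed S G -> pdeK S *m ltiD G = 0.
Proof.
move=> [wp _]; apply/matrixP => i j; rewrite [RHS]mxE.
apply/eqP/negPn/negP => c0; set c := (_ *m _) i j in c0.
have [v [w [y [z [X [_ vwd [_ _ [zsol zdom] wE] Xsol yE]]]]]] :=
  wp _ (switch_L2e j).
have [[zt [zC _]] _] := zsol.
pose b t := bvec m (z t).
(* The boundary condition K_B b = K (C X + D (L b + d)) solved for K D d, in row i. *)
pose h t := ((pdeKB S - pdeK S *m ltiD G *m pdeL S) *m b t
  - pdeK S *m ltiC G *m X t) i 0.
have hE : {ae mu, forall t : R, 0 <= t -> h t = if 1 <= t then c else 0}.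
  apply: ae_imply2 vwd yE => t vt yt t0.
  have := (zdom t t0).2; rewrite -/(b t) yt// vt// wE// -/(b t) => KBb.
  rewrite /h mulmxBl KBb !mulmxDr !mulmxA.
  have -> (x1 x2 x3 : 'cV[R]_(m * l)) : x1 + (x2 + x3) - x2 - x1 = x3.
    by apply/matrixP => ? ?; rewrite !mxE; ring.
  rewrite /switch; case: ifP => _; last by rewrite mulmx0 mxE.
  by rewrite -colE mxE.
have hc : h s @[s --> within `[0, +oo[ (nbhs (1 : R))] --> h 1.
  have cb q : b s q 0 @[s --> within `[0, +oo[ (nbhs (1 : R))] --> b 1 q 0.
    have /subspace_continuousP := bvec_continuous (j := q) zC.
    by apply; rewrite /= in_itv /= ler01.
  have cX q : X s q 0 @[s --> within `[0, +oo[ (nbhs (1 : R))] --> X 1 q 0.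
    have /subspace_continuousP := ode_continuous (i := q) Xsol.
    by apply; rewrite /= in_itv /= ler01.
  rewrite /h mxE; under eq_fun do rewrite mxE.
  apply: cvgD; first exact: cvg_mulmx.
  rewrite mxE; under eq_fun do rewrite mxE.
  by apply: cvgN; exact: cvg_mulmx.
(* Arbitrarily close to 1, [h] takes the value 0 on the left and [c] on the right; both would lie
   within |c| / 2 of [h 1]. Capping the radius at 1 keeps the left points in the half line. *)
move/cvgrPdist_lt : hc => /(_ (`|c| / 2)); rewrite divr_gt0 ?normr_gt0//.
move=> /(_ isT); rewrite near_withinE => /nbhs_ballP[d /= d0 dh].
pose d1 := Num.min d 1.
have d10 : 0 < d1 by rewrite lt_min d0 ltr01.
have [d1d d11] : d1 <= d /\ d1 <= 1 by rewrite !ge_min !lexx orbT.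
have near_h s : `|1 - s| < d1 -> `|h 1 - h s| < `|c| / 2.
  move=> sd; apply: dh; first exact: lt_le_trans sd d1d.
  have := ler_norm (1 - s); rewrite /= in_itv /= andbT; lra.
have [s /andP[s1 s2] hs] := @ae_exists_itv _ (1 - d1) 1 (ltac:(lra)) hE.
have [t /andP[t1 t2] ht] := @ae_exists_itv _ 1 (1 + d1) (ltac:(lra)) hE.
have hs0 : h s = 0 by rewrite hs ?leNgt ?s2//; lra.
have htc : h t = c by rewrite ht ?(ltW t1)//; lra.
have := near_h s; rewrite hs0 gtr0_norm ?subr_gt0// => /(_ ltac:(lra)) A.
have := near_h t; rewrite htc ltr0_norm ?subr_lt0// => /(_ ltac:(lra)) B.
have := ler_normB (h 1 - 0) (h 1 - c).
by rewrite (_ : h 1 - 0 - (h 1 - c) = c); [lra|ring].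
Qed.

End WellPosedness.

(** * Stability *)

Section Trajectories.
Variable R : realType.
Notation mu := (@lebesgue_measure R).

Lemma ode_solution_col a b (x f : R -> 'cV[R]_a) (x' f' : R -> 'cV[R]_b) :
  ode_solution x f -> ode_solution x' f' ->
  ode_solution (fun t => col_mx (x t) (x' t)) (fun t => col_mx (f t) (f' t)).
Proof.
move=> xf xf' T i T0; case: (split_ordP i) => j ->.
  rewrite col_mxEu.
  have -> : (fun t => col_mx (f t) (f' t) (lshift b j) 0) = (fun t => f t j 0).
    by apply/funext => t; rewrite col_mxEu.
  exact: xf.
rewrite col_mxEd.
have -> : (fun t => col_mx (f t) (f' t) (rshift a j) 0) = (fun t => f' t j 0).
  by apply/funext => t; rewrite col_mxEd.
exact: xf'.
Qed.

Variables (m l n r p nxi q : nat).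
Variables (S : pde R m l p r) (G : lti R n r p).
Variable Psi : filt R nxi p (2 * m * l) q.

(** The forcing built from y and the boundary values is locally square integrable, hence integrable
    on bounded intervals, which is all that the Picard construction asks for. *)
Lemma filt_state_exists (y : R -> 'cV[R]_p) (z : R -> jet R l) :
  L2e y -> L2e (fun t => bvec m (z t)) -> exists xi, filt_state Psi y z xi.
Proof.
move=> yL bL; pose f t := filtBy Psi *m y t + filtBb Psi *m bvec m (z t).
have fi (T : R) i : 0 <= T ->
    mu.-integrable `[0, T] (EFin \o (fun t => f t i 0)).
  move=> T0; apply: sqint_integrable => //; first exact: lebesgue_itv_finite.
  apply: (@eq_sqint _ _ (fun t => (filtBy Psi *m y t) i 0
      + (filtBb Psi *m bvec m (z t)) i 0)) => //.
    by move=> t _; rewrite [RHS]mxE.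
  by apply: sqintD => //; apply: sqint_mulmx => // j; exact: L2e_sqint.
have [xi xisol] := linear_ode (filtA Psi) fi.
exists xi; rewrite /filt_state; move: xisol; congr ode_solution.
by apply/funext => t; rewrite addrA.
Qed.

Lemma filt_out_sqint (y : R -> 'cV[R]_p) (z : R -> jet R l) xi (T : R) i :
  L2e y -> L2e (fun t => bvec m (z t)) -> filt_state Psi y z xi -> 0 <= T ->
  sqint `[0, T] (fun t => filt_out Psi y z xi t i 0).
Proof.
move=> yL bL xif T0.
apply: (@eq_sqint _ _ (fun t => (filtC Psi *m xi t) i 0
   + ((filtDy Psi *m y t) i 0 + (filtDb Psi *m bvec m (z t)) i 0))) => //.
  by move=> t _; rewrite /filt_out [RHS]mxE [X in _ = X + _]mxE addrA.
apply: sqintD => //.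
  by apply: sqint_mulmx => // j; exact: ode_sqint xif T0.
by apply: sqintD => //; apply: sqint_mulmx => // j; exact: L2e_sqint.
Qed.

Lemma augmented_state (xi : 'cV[R]_nxi) (X : 'cV[R]_n) (b : 'cV[R]_(2 * m * l))
    (d v : 'cV[R]_r) (y : 'cV[R]_p) :
  v = pdeL S *m b + d -> y = ltiC G *m X + ltiD G *m v ->
  col_mx (filtA Psi *m xi + filtBy Psi *m y + filtBb Psi *m b)
         (ltiA G *m X + ltiB G *m v) =
  augA G Psi *m col_mx xi X + augB S G Psi *m b + augE G Psi *m d.
Proof.
move=> -> ->; rewrite /augA /augB /augE mul_block_col !mul_col_mx !add_col_mx.
rewrite mul0mx add0r !mulmxDr !mulmxDl !mulmxA; congr col_mx.
  by apply/matrixP => i j; rewrite !mxE; ring.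
by rewrite addrA.
Qed.

Lemma augmented_output (xi : 'cV[R]_nxi) (X : 'cV[R]_n) (b : 'cV[R]_(2 * m * l))
    (d v : 'cV[R]_r) (y : 'cV[R]_p) :
  v = pdeL S *m b + d -> y = ltiC G *m X + ltiD G *m v ->
  filtC Psi *m xi + filtDy Psi *m y + filtDb Psi *m b =
  augC G Psi *m col_mx xi X + augD S G Psi *m b + augF G Psi *m d.
Proof.
move=> -> ->; rewrite /augC /augD /augF mul_row_col !mulmxDr !mulmxDl !mulmxA.
by rewrite -!addrA; do 2 congr (_ + _); rewrite addrCA addrC -!addrA.
Qed.

End Trajectories.

Theorem theorem1 (R : realType) (m l n r p nxi q nperp : nat)
  (hm : (1 <= m)%N) (hl : (1 <= l)%N)
  (S : pde R m l p r) (G : lti R n r p) (Psi : filt R nxi p (2 * m * l) q)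
  (hF : pdeF S ord_max != 0)
  (hKB : \rank (pdeKB S) = (m * l)%N)
  (hwp : well_posed S G)
  (P : 'M[R]_(nxi + n)) (M : 'M[R]_q) (Z : 'M[R]_nxi)
  (hP : P^T = P) (hM : M^T = M) (hZ : Z^T = Z)
  (hIQC : finite_horizon_IQC S Psi M Z)
  (Kperp : 'M[R]_((nxi + n) + 2 * m * l, nperp))
  (hKperp : null_basis (Kcirc nxi S G) Kperp)
  (hLMI : negdef (Kperp^T *m (outer S G Psi)^T *m middle P M
                    *m outer S G Psi *m Kperp))
  (hPZ : posdef (P - block_mx Z 0 0 (0 : 'M[R]_n))) :
  exists gamma : R,
    forall (d v w : R -> 'cV[R]_r) (y : R -> 'cV[R]_p)
      (z : R -> jet R l) (X : R -> 'cV[R]_n),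
      trajectory S G d v w y z X ->
      forall T : R, 0 <= T ->
        \int[@lebesgue_measure R]_(s in `[0, T]) sqnorm (y s)
        <= gamma ^+ 2 * \int[@lebesgue_measure R]_(s in `[0, T]) sqnorm (d s).
Proof.
have [del [kap [del0 kap0 diss]]] := dissipation hP hKperp hLMI hM.
exists (Num.sqrt (kap / del)) => d v w y z X traj T T0.
rewrite sqr_sqrtr; last by rewrite divr_ge0// ltW.
have [[dL vL] vwd [yL wL ztraj wE] Xsol yE] := traj.
have [[[zt [zC _]] _] zdom] := ztraj.
pose b t := bvec m (z t).
have bL : L2e b by apply: continuous_L2e => j; exact: bvec_continuous zC.
have [xi xisol] := filt_state_exists Psi yL bL.
have Ysol := ode_solution_col xisol Xsol.
set Y := (fun t => col_mx _ _) in Ysol.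
set g := (fun t => col_mx _ _) in Ysol.
have [intP VT] := ode_quadform Ysol T0 hP.
pose psi := filt_out Psi y z xi.
have psi2 i : sqint `[0, T] (fun t => psi t i 0) by exact: filt_out_sqint.
have intM : (@lebesgue_measure R).-integrable `[0, T]
    (EFin \o (fun t => quadform M (psi t))) by exact: sqint_bilin.
have inty := sqint_sqnorm (measurable_itv `[0, T]) (L2e_sqint T0 yL).
have intd := sqint_sqnorm (measurable_itv `[0, T]) (L2e_sqint T0 dL).
(* Only an almost everywhere statement is possible: the boundary condition holds at every t, but the
   interconnection v = w + d and the plant output equation do not. *)
have pw : {ae @lebesgue_measure R, forall t : R, `[0, T]%classic t ->
    2 * bilin P (Y t) (g t) + quadform M (psi t) + del * sqnorm (y t)
    <= kap * sqnorm (d t)}.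
  apply: ae_imply2 vwd yE => t vt yt; rewrite /= in_itv /= => /andP[t0 _].
  have vE : v t = pdeL S *m b t + d t by rewrite vt// wE.
  have KBb : pdeKB S *m b t = pdeK S *m ltiC G *m X t.
    have [_ ->] := zdom t t0; rewrite yt// mulmxDr !mulmxA.
    by rewrite (no_feedthrough hwp) mul0mx addr0.
  have := diss (xi t) (X t) (b t) (d t) (v t) (y t) KBb vE (yt t0).
  by rewrite -(augmented_state _ _ vE (yt t0)) -(augmented_output _ _ vE (yt t0)).
have intPM := integrableD_real (measurable_itv _) intP intM.
have intdy := integrableZl_real del (measurable_itv _) inty.
have intkd := integrableZl_real kap (measurable_itv _) intd.
have := ae_le_Rintegral (measurable_itv _)
  (integrableD_real (measurable_itv _) intPM intdy) intkd pw.
rewrite RintegralD// RintegralD// -VT !RintegralZl//.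
have := hIQC y z xi ztraj yL bL xisol T T0.
(* The form of diag(Z, 0) at [Y T] sees only [xi T]. The case [Y T = 0] is separate because [posdef]
   speaks of nonzero vectors. *)
have Zle : quadform Z (xi T) <= quadform P (Y T).
  have : 0 <= quadform (P - block_mx Z 0 0 (0 : 'M[R]_n)) (Y T).
    have [->|/(proj2 hPZ)/ltW//] := eqVneq (Y T) 0.
    by rewrite /quadform mulmx0 mxE.
  rewrite /quadform mulmxBr mulmxBl [X in 0 <= X]mxE [X in _ + X]mxE subr_ge0.
  rewrite /Y tr_col_mx -mulmxA mul_block_col !mul0mx !addr0 mul_row_col mulmx0.
  by rewrite addr0 mulmxA.
move=> IQC diss_int.
rewrite mulrAC ler_pdivlMr// mulrC; lra.
Qed.
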